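(* Let $G$ be a countable group, and let $M=(\mu_n)_{n=1}^\infty$ be a sequence of probability measures on $G$ that measures index uniformly. Then the following hold. (1) If $\textup{dc}_M(G)>\frac{5}{8}$ then $G$ is abelian. (2) If $\textup{dc}_M(G)\ge\frac{1}{2}+\varepsilon$ for some $\varepsilon>0$ then the centre of $G$ has index at most $\frac{1}{\varepsilon}$ in $G$. (3) There is an absolute constant $C>0$ such that if $G$ is finitely generated and $\textup{dc}_M(G)\ge\alpha>0$ then $G$ has a normal subgroup $\Gamma$ of index at most $\lceil\alpha^{-1}\rceil$ and a normal subgroup $H$ of cardinality at most $\exp(C\alpha^{-C})$ such that $H\subset\Gamma$ and $\Gamma/H$ is abelian.
   Context: $M$ measures index uniformly if $\mu_n(xH)\to1/[G:H]$ uniformly over all $x\in G$ and all subgroups $H$ of $G$, with $1/[G:H]=0$ when $H$ has infinite index. For a probability measure $\mu$, $\textup{dc}_\mu(G)=(\mu\times\mu)(\{(x,y):xy=yx\})$, and $\textup{dc}_M(G)=\limsup_{n\to\infty}\textup{dc}_{\mu_n}(G)$. *)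

(* Defs.v *)
From HB Require Import structures.
From mathcomp Require Import all_boot all_order all_algebra.
From mathcomp Require Import all_classical all_reals all_analysis.
Set Implicit Arguments. Unset Strict Implicit. Unset Printing Implicit Defensive.
Import Order.TTheory GRing.Theory Num.Theory.
Local Open Scope classical_set_scope.
Local Open Scope ring_scope.

Section Defs.
Variables (R : realType) (G : groupType).

Definition is_subgroup (H : set G) : Prop :=
  H 1%g /\ (forall x y, H x -> H y -> H (x * y^-1)%g).

Definition is_normal (H : set G) : Prop :=
  is_subgroup H /\ (forall g h, H h -> H (g^-1 * h * g)%g).

Definition left_coset (x : G) (H : set G) : set G := [set (x * h)%g | h in H].

(* [G : H] = n : the left cosets of H are exactly r_0 H, ..., r_{n-1} H,
   pairwise distinct *)
Definition index_eq (H : set G) (n : nat) : Prop :=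
  exists r : 'I_n -> G, forall x : G, exists! i : 'I_n, left_coset (r i) H x.

(* 1/[G : H], with the convention 1/[G:H] = 0 when the index is infinite *)
Definition inv_index (H : set G) : R :=
  match pselect (exists n, index_eq H n) with
  | left P => ((projT1 (cid P))%:R)^-1
  | right _ => 0
  end.

(* probability measures on (countable) G, given by their mass function *)
Definition is_prob (mu : G -> R) : Prop :=
  (forall x, 0 <= mu x) /\ (\esum_(x in [set: G]) (mu x)%:E = 1)%E.

(* mu(A), as a real number (finite for probability measures) *)
Definition pmeas (mu : G -> R) (A : set G) : R :=
  fine (\esum_(x in A) (mu x)%:E).

Definition measures_index_uniformly (M : nat -> G -> R) : Prop :=
  forall e : R, 0 < e -> exists N : nat, forall n : nat, (N <= n)%N ->
    forall (x : G) (H : set G), is_subgroup H ->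
      `| pmeas (M n) (left_coset x H) - inv_index H | < e.

Definition dc (mu : G -> R) : \bar R :=
  \esum_(p in [set p : G * G | (p.1 * p.2 = p.2 * p.1)%g]) (mu p.1 * mu p.2)%:E.

Definition dcM (M : nat -> G -> R) : \bar R := limn_esup (fun n => dc (M n)).

Definition is_abelian : Prop := forall x y : G, (x * y = y * x)%g.

Definition centre : set G := [set z | forall g : G, (z * g = g * z)%g].

Definition finitely_generated : Prop :=
  exists s : seq G, forall H : set G, is_subgroup H ->
    (forall g, g \in s -> H g) -> H = [set: G].

Definition card_atmost (H : set G) (m : R) : Prop :=
  exists s : seq G, (forall h, H h -> h \in s) /\ (size s)%:R <= m.

End Defs.

(* Main.v *)
(* Averaging over x, the hypothesis says that the centralisers C(x) have large
   index-measure 1/[G : C(x)] on average, so that many x have few conjugates.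
   For (1) and (2) it suffices to compare the centre with its complement, where
   1/[G : C(x)] <= 1/2.

   For (3), take r of order alpha^-2. As G is finitely generated it has finitely
   many subgroups of index at most r, so {x : [G : C(x)] <= r} is a finite union
   of centralisers of such subgroups, and those of infinite index have measure
   tending to 0. The others generate Gamma, of index at most
   1 / (alpha - 1/(r + 1)). A finite part of the derived subgroup of Gamma can be
   detected in a finite quotient of G, because the intersection of a subgroup
   with its centraliser is abelian, hence G is virtually abelian and residually
   finite. This leaves a statement on a finite group: if X is a symmetric set of
   density 1/K all of whose elements have at most r conjugates, then <X>' has
   order at most exp(poly(r, K)). There <X> = X^m with m = 3K, so all elements of
   <X> have at most n = r^m conjugates. For x in X the normal closure of [x, <X>]
   is generated by at most r^2 elements, of bounded order by transfer to the
   centre of the normal closure of x, so it is small by Dietzmann's lemma; an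
   argument of Wiegold on an element with the most conjugates shows that <X>' lies
   in a product of polynomially many of these normal subgroups. *)

Require Import Defs.
From HB Require Import structures.
From mathcomp Require Import all_boot all_order all_algebra.
From mathcomp Require Import all_fingroup all_solvable.
From mathcomp Require Import zify ring lra.
Set Implicit Arguments. Unset Strict Implicit. Unset Printing Implicit Defensive.

(** * Finite groups with a dense set of elements of small class *)

Section FiniteGroups.
Local Open Scope group_scope.
Variable gT : finGroupType.
Implicit Types (G A H M : {group gT}) (X T : {set gT}).

Lemma exp_index_normal G A x : A <| G -> x \in G -> x ^+ #|G : A| \in A.
Proof.
move=> nAG Gx; have Nx : x \in 'N(A) by apply: (subsetP (normal_norm nAG)).
apply: coset_idr; first exact: groupX.
rewrite morphX //= -card_quotient ?normal_norm //.
by apply: expg_cardG; apply: mem_quotient.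
Qed.

(** The transfer [V] into the abelian group ['Z(G)] is a homomorphism, so the assumption kills
    [V t *+ d] for [t = x^-1 * y]. With [Q] the index of the centre, [t ^+ Q] is central and [V]
    acts on the centre as the [Q]-th power, so [Q * V t] is [t ^+ (Q ^ 2)]. *)
Lemma commg_order_center G x y d : x \in G -> y \in G -> x ^+ d = y ^+ d ->
  (x^-1 * y) ^+ (#|G : 'Z(G)| ^ 2 * d) = 1.
Proof.
move=> Gx Gy xyd; set Q := #|G : 'Z(G)|; set t := x^-1 * y.
have Gt : t \in G by rewrite groupM ?groupV.
have sZG : 'Z(G) \subset G := center_sub G.
have abZ : abelian (idm 'Z(G) @* 'Z(G)) by rewrite morphim_idm ?center_abelian.
pose V := transfer G abZ.
have VM : {in G &, forall u v, V (u * v) = (V u + V v)%R} by exact: transferM.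
have V1 : V 1 = 0%R by apply: (GRing.addrI (V 1)); rewrite -VM // mulg1 GRing.addr0.
have VX z n : z \in G -> V (z ^+ n) = (V z *+ n)%R.
  move=> Gz; elim: n => [|n IH]; first by rewrite expg0 V1 GRing.mulr0n.
  by rewrite expgS VM ?groupX // IH GRing.mulrS.
have Vt : (V t *+ d = 0)%R.
  rewrite VM ?groupV // GRing.mulrnDl -!VX ?groupV // -VM ?groupX ?groupV //.
  by rewrite expVgn xyd mulVg.
have Zt : t ^+ Q \in 'Z(G) by apply: exp_index_normal => //; apply: center_normal.
have VZ z : z \in 'Z(G) -> V z = (FiniteModule.fmod abZ z *+ Q)%R.
  move=> Zz; have cz h : h \in G -> h * z = z * h.
    by move=> Gh; have /centerP[_ /(_ h Gh)] := Zz.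
  rewrite /V /transfer -[Q]/#|rcosets 'Z(G) G| -GRing.sumr_const.
  apply: eq_bigr => _ /rcosetsP[g Gg ->].
  have -> : 'Z(G) :* g :* z = 'Z(G) :* g.
    by rewrite -rcosetM cz // rcosetM rcoset_id.
  case: repr_rcosetP => h Zh.
  have Gh := subsetP sZG h Zh.
  by rewrite cz ?groupM // mulgK.
have := VX t Q Gt; rewrite VZ // => /(congr1 (fun u => (u *+ d)%R)).
rewrite -GRing.mulrnA GRing.mulrnAC Vt GRing.mul0rn.
move/(congr1 val); rewrite [LHS]FiniteModule.fmvalZ FiniteModule.fmodK => [wQ|]; last by rewrite /= morphim_idm.
by rewrite expnS expn1 -mulnA expgM; exact: wQ.
Qed.

Lemma index_cent_le G X n : (forall x, x \in X -> #|x ^: G| <= n) ->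
  #|G : 'C_G(X)| <= n ^ #|X|.
Proof.
move: {2}#|X| (erefl #|X|) => k; elim: k X => [|k IH] X cX bX.
  by rewrite (cards0_eq cX) cards0 expn0 (setIidPl _) ?indexgg // centsC sub0set.
have /card_gt0P[x Xx] : 0 < #|X| by rewrite cX.
rewrite (cardsD1 x) Xx expnS -{1}(setD1K Xx) centU setIA cent_set1.
have {}IH : #|G : 'C_G(X :\ x)| <= n ^ #|X :\ x|.
  by apply: IH => [|y /setD1P[_ /bX]//]; move: cX; rewrite (cardsD1 x) Xx => -[].
rewrite -(Lagrange_index (subsetIl G 'C[x])) ?subsetIl //.
rewrite index_cent1; apply: leq_mul; first exact: bX.
apply: leq_trans IH; rewrite /=.
have -> : 'C_G[x] :&: 'C(X :\ x) = 'C_G[x] :&: 'C_G(X :\ x).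
  by rewrite setIACA setIid setIA.
rewrite indexgI -(leq_pmul2r (cardG_gt0 'C_G(X :\ x))) LagrangeMr mulnC.
rewrite Lagrange ?subsetIl //; apply: subset_leq_card.
by rewrite mul_subG ?subsetIl.
Qed.

Lemma card_expgs_le (S : {set gT}) k : #|S ^+ k| <= #|S| ^ k.
Proof.
elim: k => [|k IH]; first by rewrite expg0 cards1.
rewrite expgS expnS; apply: leq_trans (leq_mul (leqnn _) IH).
by rewrite -cardsX /mulg /= /set_mulg curry_imset2X leq_imset_card.
Qed.

Lemma mem_expgs_seq (S : {set gT}) k x :
  reflect (exists2 s : seq gT, size s = k /\ all (mem S) s & x = \prod_(y <- s) y)
          (x \in S ^+ k).
Proof.
apply: (iffP idP); last first.
  case=> s [<- +] ->; elim: s => [|y s IH] /=; first by rewrite big_nil expg0 set11.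
  by case/andP=> Sy /IH Ss; rewrite big_cons expgS mem_mulg.
elim: k x => [|k IH] x.
  by rewrite expg0 => /set1P ->; exists [::]; rewrite ?big_nil.
rewrite expgS => /mulsgP[y z Sy /IH[s [<- Ss] ->] ->].
by exists (y :: s); rewrite /= ?big_cons ?Sy.
Qed.

(* Dietzmann: with U the union of the cyclic groups of the elements of T, a
   product of #|T| + 1 elements of U has two factors in the same cyclic group;
   they can be merged after conjugating what is in between. *)
Lemma dietzmann T e : (forall t u, t \in T -> u \in T -> t ^ u \in T) ->
  (forall t, t \in T -> #[t] <= e) -> #|<<T>>| <= (#|T| * e) ^ #|T|.
Proof.
move=> nT eT; pose U := \bigcup_(t in T) <[t]>.
have cU : #|U| <= #|T| * e.
  rewrite -sum_nat_const /U; elim/big_rec2: _ => [|t n V Tt IH]; first by rewrite cards0.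
  by rewrite (leq_trans (leq_card_setU _ _)) // leq_add // -orderE eT.
have nTX t u n : t \in T -> u \in T -> t ^ (u ^+ n) \in T.
  move=> Tt Tu; elim: n => [|n IH]; first by rewrite expg0 conjg1.
  by rewrite expgSr conjgM nT.
have nU u v : u \in U -> v \in U -> u ^ v \in U.
  case/bigcupP=> t Tt tu /bigcupP[w Tw] /cycleP[n ->].
  apply/bigcupP; exists (t ^ (w ^+ n)); first exact: nTX.
  by rewrite cycleJ memJ_conjg.
have cUT : #|(U ^+ #|T|)| <= (#|T| * e) ^ #|T|.
 apply: leq_trans (card_expgs_le _ _) _.
 by have [->|T0] := posnP #|T|; rewrite ?expn0 ?leq_exp2r.
have U1 k : 0 < #|T| -> U ^+ k \subset U ^+ k.+1.
  move=> /card_gt0P[t Tt]; rewrite expgS -{1}[U ^+ k]mul1g mulSg // sub1set.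
  by apply/bigcupP; exists t; rewrite ?group1.
have US : U ^+ #|T|.+1 \subset U ^+ #|T|.
  apply/subsetP => _ /mem_expgs_seq[s [sT Us] ->].
  have [f fP] : exists f : gT -> gT, forall u, u \in U -> f u \in T /\ u \in <[f u]>.
    exists (fun u => odflt 1 [pick t | (t \in T) && (u \in <[t]>)]) => u /bigcupP[t Tt tu].
    by case: pickP => [v /andP[]//|/(_ t)]; rewrite Tt tu.
  have : ~~ uniq (map f s).
    apply/negP => /card_uniqP; rewrite size_map sT => c.
    suff: #|map f s| <= #|T| by rewrite c ltnn.
    apply/subset_leq_card/subsetP => _ /mapP[u su ->].
    by have [] := fP u (allP Us u su).
  move=> /(uniqPn 1)[i [j [ij js]]]; rewrite size_map in js.
  have is_ : i < size s by apply: ltn_trans js.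
  rewrite !(nth_map 1) // => fij.
  set a := nth 1 s i in fij; set b := nth 1 s j in fij.
  have Ua : a \in U by apply/(allP Us)/mem_nth.
  have Ub : b \in U by apply/(allP Us)/mem_nth.
  have Uab : a * b \in U.
    have [Ta aa] := fP a Ua; have [_ bb] := fP b Ub.
    by apply/bigcupP; exists (f a); rewrite // groupM // fij.
  have def_s : s = take i s ++ a :: take (j - i.+1) (drop i.+1 s) ++ b :: drop j.+1 s.
    rewrite -{1}(cat_take_drop i s) (drop_nth 1) //; congr (_ ++ _ :: _).
    rewrite -{1}(cat_take_drop (j - i.+1) (drop i.+1 s)) drop_drop subnK //.
    by rewrite (drop_nth 1 js).
  move: Us sT; rewrite def_s !all_cat /= !all_cat /=.
  set s1 := take i s; set s2 := take _ _; set s3 := drop _ s.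
  move=> /and4P[Us1 _ Us2 /andP[_ Us3]] sT.
  apply/mem_expgs_seq; exists (s1 ++ a * b :: [seq u ^ b | u <- s2] ++ s3).
    split; first by move: sT; rewrite !size_cat /= !size_cat /= size_map; lia.
    rewrite !all_cat /= all_cat Us1 Us3 /= andbT; apply/andP; split => //.
    by apply/allP => _ /mapP[u s2u ->]; apply: nU => //; apply: (allP Us2).
  rewrite big_cat big_cons big_cat big_cons big_cat big_cons big_cat big_map -conjg_prod /=.
  by rewrite /conjg !mulgA mulgK.
(* For empty [T] the set [U] is empty too and does not contain 1, so the chain of powers of [U] is
   of no use. *)
have [T0|T0] := posnP #|T|.
  by rewrite (cards0_eq T0) gen0 cards1 cards0 expn0.
apply: leq_trans cUT; apply/subset_leq_card.
have UU n : #|T| <= n -> U ^+ n \subset U ^+ #|T|.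
  elim: n => [|n IH]; first by rewrite leqn0 => /eqP ->.
  rewrite leq_eqVlt => /predU1P[<- //|Tn].
  by rewrite expgS (subset_trans (mulgS _ (IH Tn))) // -expgS.
have Un n : U ^+ n \subset U ^+ #|T|.
  have [/UU//|] := leqP #|T| n; move=> /ltnW /subnKC <-.
  elim: (#|T| - n) => [|k IH]; first by rewrite addn0.
  by rewrite addnS (subset_trans IH) // U1.
have [n ->] := gen_expgs T; apply: subset_trans (Un n).
elim: n => [|n IH]; first by rewrite !expg0.
rewrite !expgS mulgSS // subUset sub1set; apply/andP; split.
  by move/card_gt0P: T0 => [t Tt]; apply/bigcupP; exists t; rewrite ?group1.
by apply/subsetP => t Tt; apply/bigcupP; exists t; rewrite ?cycle_id.
Qed.

Lemma card_classM G x y : #|(x * y) ^: G| <= #|x ^: G| * #|y ^: G|.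
Proof.
rewrite -cardsX; apply: leq_trans (leq_imset_card (fun p => p.1 * p.2) _).
apply/subset_leq_card/subsetP => _ /imsetP[g Gg ->]; apply/imsetP.
by exists (x ^ g, y ^ g); rewrite ?conjMg // in_setX !memJ_class.
Qed.

Lemma card_class_prod G r (s : seq gT) : (forall x, x \in s -> #|x ^: G| <= r) ->
  #|(\prod_(x <- s) x) ^: G| <= r ^ size s.
Proof.
elim: s => [|x s IH] sr; first by rewrite big_nil class1G cards1.
rewrite big_cons expnS; apply: leq_trans (card_classM _ _ _) (leq_mul _ _).
  by rewrite sr ?mem_head.
by apply: IH => y sy; rewrite sr // inE sy orbT.
Qed.

(** Take for [d] the index of the centraliser of [h] in [<[b]>]: then [b ^+ d] commutes with [h]. *)
Lemma exists_exp_eq G b h n : b \in G -> h \in G -> #|h ^: G| <= n ->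
  exists d, [/\ 0 < d, d <= n & (b ^ h) ^+ d = b ^+ d].
Proof.
move=> Gb Gh hn; have sbG : <[b]> \subset G by rewrite cycle_subG.
exists #|<[b]> : 'C_<[b]>[h]|; split=> //.
  by rewrite index_cent1 (leq_trans _ hn) // subset_leq_card // imsetS.
have : b ^+ #|<[b]> : 'C_<[b]>[h]| \in 'C_<[b]>[h].
  apply: exp_index_normal; last exact: cycle_id.
  by rewrite -sub_abelian_normal ?cycle_abelian ?subsetIl.
rewrite inE => /andP[_ /cent1P c].
by rewrite -conjXg /conjg c mulKg.
Qed.

(** These are exactly the conjugates of the commutators [[~ x, h]], a set closed under conjugation
    as Dietzmann's lemma requires; it generates the normal closure of [[x, G]]. *)
Definition class_diffs G x := [set b^-1 * c | b in x ^: G, c in x ^: G].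
Definition class_diff_group G x := <<class_diffs G x>>%G.

Lemma class_diffs_J G x t g : g \in G -> t \in class_diffs G x ->
  t ^ g \in class_diffs G x.
Proof.
move=> Gg /imset2P[b c xb xc ->]; rewrite conjMg conjVg.
by apply/imset2P; exists (b ^ g) (c ^ g); rewrite // memJ_norm // (subsetP (class_norm x G)).
Qed.

Lemma class_diffs_sub G x : x \in G -> class_diffs G x \subset G.
Proof.
move=> Gx; apply/subsetP => _ /imset2P[b c xb xc ->].
by rewrite groupM ?groupV // (subsetP (class_subG Gx (subxx _))).
Qed.

Lemma class_diff_group_norm G x : G \subset 'N(class_diff_group G x).
Proof.
apply: norms_gen; apply/normsP => g Gg; apply/eqP; rewrite eqEcard cardJg leqnn andbT.
by apply/subsetP => _ /imsetP[t Tt ->]; apply: class_diffs_J.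
Qed.

Lemma class_diff_commg G x g : g \in G -> [~ x, g] \in class_diff_group G x.
Proof.
move=> Gg; apply: mem_gen; apply/imset2P; exists x (x ^ g) => //.
  exact: class_refl.
exact: memJ_class.
Qed.

Section Bound.
Variables (G : {group gT}) (r n : nat).
Hypothesis Gn : forall g, g \in G -> #|g ^: G| <= n.

(** Both factors lie in the normal closure [A] of [x] and share a [d]-th power with [d <= n]. The
    centre of [A] is the centraliser of at most [r] generators, each with at most [r] conjugates, so
    its index is at most [r ^ r] and the transfer bound applies. *)
Lemma class_diffs_order x t : x \in G -> #|x ^: G| <= r -> t \in class_diffs G x ->
  #[t] <= (r ^ r) ^ 2 * n.
Proof.
move=> Gx xr /imset2P[_ _ /imsetP[g Gg ->] /imsetP[h Gh ->] ->].
set b := x ^ g; have Gb : b \in G by rewrite groupJ.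
have -> : x ^ h = b ^ (g^-1 * h) by rewrite -conjgM mulKVg.
have Gk : g^-1 * h \in G by rewrite groupM ?groupV.
move: (g^-1 * h) Gk => k Gk {h Gh}.
have [d [d0 dn bd]] := exists_exp_eq Gb Gk (Gn Gk).
pose A := <<x ^: G>>%G.
have sAG : A \subset G by rewrite gen_subG class_subG.
have Ab : b \in A by rewrite mem_gen ?memJ_class.
have Abk : b ^ k \in A by rewrite mem_gen // /b -conjgM memJ_class ?groupM.
have r0 : 0 < r by apply: leq_trans xr; apply/card_gt0P; exists x; apply: class_refl.
have AZ : #|A : 'Z(A)| <= r ^ r.
  rewrite /center cent_gen; apply: leq_trans (index_cent_le (n := r) _) _ => [y xy|].
    apply: leq_trans xr; apply: subset_leq_card.
    by rewrite -(class_eqP xy) imsetS.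
  by rewrite leq_pexp2l.
have := commg_order_center Ab Abk (esym bd) => /eqP; rewrite -order_dvdn => /dvdn_leq.
have Q0 : 0 < #|A : 'Z(A)| by [].
rewrite muln_gt0 expn_gt0 Q0 d0 => /(_ isT) /leq_trans; apply.
by rewrite leq_mul // leq_exp2r.
Qed.

Lemma card_class_diff_group x : x \in G -> #|x ^: G| <= r ->
  #|class_diff_group G x| <= (r ^ 2 * ((r ^ r) ^ 2 * n)) ^ (r ^ 2).
Proof.
move=> Gx xr; have T0 : #|class_diffs G x| <= r ^ 2.
  apply: leq_trans (_ : #|setX (x ^: G) (x ^: G)| <= _); last by rewrite cardsX leq_mul.
  by rewrite /class_diffs curry_imset2X leq_imset_card.
have r0 : 0 < r by apply: leq_trans xr; apply/card_gt0P; exists x; apply: class_refl.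
have n0 : 0 < n by apply: leq_trans (Gn Gx); apply/card_gt0P; exists x; apply: class_refl.
have B0 : 0 < r ^ 2 * ((r ^ r) ^ 2 * n) by rewrite !muln_gt0 !expn_gt0 r0 n0.
apply: leq_trans (dietzmann (e := (r ^ r) ^ 2 * n) _ _) _ => [t u Tt Tu|t Tt|].
- by apply: class_diffs_J => //; apply: (subsetP (class_diffs_sub Gx)).
- exact: class_diffs_order Tt.
- apply: leq_trans (_ : (r ^ 2 * ((r ^ r) ^ 2 * n)) ^ #|class_diffs G x| <= _).
    have [->|c0] := posnP #|class_diffs G x|; first by rewrite !expn0.
    by rewrite leq_exp2r // leq_mul2r T0 orbT.
  by rewrite leq_pexp2l.
Qed.
End Bound.

(** Each element of [X] outside the current subgroup at least doubles it when adjoined, so the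
    number of adjoined elements is logarithmic in the index. *)
Lemma few_generators G X H : <<X>> = G -> H \subset G ->
  exists s : seq gT, [/\ {subset s <= X}, 2 ^ size s <= #|G : H|
                       & G \subset <<[set x in s] :|: H>>].
Proof.
move=> genX; move: {2}#|G : H| (leqnn #|G : H|) => k.
elim: k H => [|k IH] H Hk sHG; first by rewrite leqNgt indexg_gt0 in Hk.
have [sXH|/subsetPn[x Xx Hx]] := boolP (X \subset H).
  exists [::]; split=> //; first by rewrite expn0 indexg_gt0.
  by rewrite -genX gen_subG (subset_trans sXH) // (subset_trans _ (subset_gen _)) ?subsetUr.
have Gx : x \in G by rewrite -genX mem_gen.
pose K := <<x |: H>>%G.
have sHK : H \subset K by rewrite (subset_trans (subsetUr [set x] H)) ?subset_gen.
have sKG : K \subset G by rewrite gen_subG subUset sub1set Gx.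
have LI := Lagrange_index sKG sHK.
have K2 : 2 <= #|K : H|.
  rewrite ltn_neqAle indexg_gt0 andbT eq_sym indexg_eq1.
  by apply: contra Hx => /subsetP; apply; rewrite mem_gen ?setU11.
have K0 : 0 < #|G : K| by [].
have [|s [sX s2 sG]] := IH K _ sKG; first by nia.
exists (x :: s); split=> [y||]; first by rewrite inE => /predU1P[->|/sX].
  by rewrite /= expnS -LI mulnC leq_mul.
apply: subset_trans sG _; rewrite gen_subG subUset; apply/andP; split.
  by apply/subsetP => y; rewrite inE => sy; rewrite mem_gen // !inE sy orbT.
rewrite gen_subG subUset sub1set; apply/andP; split.
  by rewrite mem_gen // !inE eqxx.
by apply/subsetP => y Hy; rewrite mem_gen // inE Hy orbT.
Qed.

Lemma product_of_normal_subgroups G (N : gT -> {group gT}) B (s : seq gT) :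
  (forall x, x \in s -> [/\ N x \subset G, G \subset 'N(N x) & #|N x| <= B]) ->
  exists M, [/\ G \subset 'N(M), #|M| <= B ^ size s
              & forall x, x \in s -> N x \subset M].
Proof.
elim: s => [|x s IH] sN; first by exists 1%G; rewrite norms1 cards1; split.
have [y sy|M [nM cM sM]] := IH; first by apply: sN; rewrite inE sy orbT.
have [sNG nN cN] := sN x (mem_head _ _).
exists (M <*> N x)%G; split.
- exact: normsY.
- rewrite /= norm_joinEr ?(subset_trans sNG) // expnS mulnC.
  by apply: leq_trans (leq_mul cM cN); rewrite mul_cardG leq_pmulr.
- move=> y; rewrite inE => /predU1P[->|/sM sy]; first exact: joing_subr.
  exact: subset_trans sy (joing_subl _ _).
Qed.

(** A crude logarithm: [r] is below [2 ^ r]. *)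
Lemma exp2_le_inv s r b : 2 ^ s <= r ^ b -> s <= r * b.
Proof.
move=> h; rewrite -(@leq_exp2l 2) // expnM; apply: (leq_trans h).
case: b {h} => [|b]; first by rewrite !expn0.
by rewrite leq_exp2r //; apply/ltnW/ltn_expl.
Qed.

(** The base is at most [2 ^ (5 * L ^ 4)] and the exponent [m + z] at most [2 * L ^ 5], which gives
    the product [10 * L ^ 9]. *)
Lemma derived_bound_le r m z L : 0 < r -> r <= L -> m <= L ->
  z <= r * (m * (r * (r * m))) ->
  ((r ^ 2 * ((r ^ r) ^ 2 * r ^ m)) ^ (r ^ 2)) ^ (m + z) <= 2 ^ (10 * L ^ 9).
Proof.
move=> r0 rL mL zm; have L0 := leq_trans r0 rL.
have p2 k b : b <= L -> b ^ k <= 2 ^ (L * k).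
  move=> bL; rewrite expnM; case: k => // k; rewrite leq_exp2r //.
  by rewrite (leq_trans bL) // ltnW // ltn_expl.
have e3 : L * 2 + L * r * 2 + L * m <= 5 * L ^ 2.
  have h1 : L * r <= L * L by rewrite leq_mul.
  have h2 : L * m <= L * L by rewrite leq_mul.
  have h3 : L <= L * L by rewrite leq_pmulr.
  by rewrite -mulnn; lia.
have h : m + z <= 2 * L ^ 5.
  rewrite mulSn mul1n leq_add //.
    by apply: leq_trans mL _; rewrite -{1}[L]expn1 leq_pexp2l.
  apply: leq_trans zm _; rewrite -[(L ^ 5)%N]/(L * (L * (L * (L * L))))%N.
  by rewrite !leq_mul.
set E := (X in (X ^ (m + z))%N).
have E2 : E <= 2 ^ (5 * L ^ 4).
  rewrite /E; apply: leq_trans (_ : (2 ^ (L * 2 + L * r * 2 + L * m)) ^ (r ^ 2) <= _).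
    rewrite leq_exp2r ?expn_gt0 ?r0 // !expnD -mulnA; apply: leq_mul; first exact: p2.
    by apply: leq_mul; [rewrite expnM leq_exp2r //; apply: p2|apply: p2].
  have rL2 : r ^ 2 <= L ^ 2 by rewrite leq_exp2r.
  by rewrite -expnM leq_exp2l // (leq_trans (leq_mul e3 rL2)) // -mulnA -expnD.
apply: leq_trans (_ : (2 ^ (5 * L ^ 4)) ^ (m + z) <= _).
  have [->|mz] := posnP (m + z); [by rewrite !expn0 | by rewrite leq_exp2r].
rewrite -expnM leq_exp2l //; apply: leq_trans (leq_mul (leqnn _) h) _.
by rewrite mulnACA -expnD.
Qed.

(** * Bounding the derived subgroup when every element is a short product of elements of small
    class *)

Section Neumann.
Variables (G : {group gT}) (X : {set gT}) (r m : nat).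
Hypotheses (sXG : X \subset G) (GX : G \subset X ^+ m).
Hypothesis r0 : 0 < r.
Hypothesis Xr : forall x, x \in X -> #|x ^: G| <= r.

Let gX : <<X>> = G.
Proof.
apply/eqP; rewrite eqEsubset gen_subG sXG (subset_trans GX) //.
apply/subsetP => _ /mem_expgs_seq[s [_ sX] ->].
rewrite big_seq; apply: group_prod => x sx; apply: mem_gen; exact: (allP sX).
Qed.

Let Gn g : g \in G -> #|g ^: G| <= r ^ m.
Proof.
move=> /(subsetP GX)/mem_expgs_seq[s [<- sX] ->]; apply: card_class_prod.
by move=> x sx; apply/Xr/(allP sX).
Qed.

(* Wiegold's argument: if [a] has a class of maximal size and [c] centralises a
   subgroup that is transitive on that class, then the class of [a * c] is the
   translate by [c] of the class of [a]. *)
Lemma central_mod_of_max_class (U M : {group gT}) a : a \in G -> U \subset G ->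
    (forall g, g \in G -> #|g ^: G| <= #|a ^: G|) -> a ^: G = a ^: U ->
    G \subset 'N(M) -> (forall g, g \in G -> [~ a, g] \in M) ->
  forall c g, c \in 'C_G(U) -> g \in G -> [~ c, g] \in M.
Proof.
move=> Ga sUG amax aU nM aM c y /setIP[Gc /centP cU] Gy.
have aUc : (a ^: G) :* c = (a * c) ^: G.
  apply/eqP; rewrite eqEcard card_rcoset amax ?groupM // andbT aU.
  apply/subsetP => _ /rcosetP[_ /imsetP[u Uu ->] ->].
  have -> : a ^ u * c = (a * c) ^ u 
    by rewrite conjMg (conjg_fixP (introT commgP (cU u Uu))).
  by rewrite memJ_class // (subsetP sUG).
have : (a * c) ^ y \in a ^: G :* c by rewrite aUc memJ_class.
case/rcosetP => _ /imsetP[g Gg ->] acy.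
(* From [a ^ y * c ^ y = a ^ g * c] the quotient for [c] is expressed by commutators of [a]. *)
have cyc : c ^ y * c^-1 = [~ a, y]^-1 * [~ a, g].
  rewrite !commgEl invMg invgK mulgA mulgK; apply: (mulgI (a ^ y)).
  by rewrite mulKVg mulgA -conjMg acy mulgK.
have : c ^ y * c^-1 \in M by rewrite cyc groupM ?groupV ?aM.
by rewrite -(memJ_norm _ (subsetP nM c Gc)) {1}/conjg mulgKV -commgEl.
Qed.

(** Let [a], a product of [m] elements [xs] of [X], have a class of maximal size. A subgroup [U]
    with few generators from [X] is transitive on that class, and [G] is generated by its
    centraliser [C] and a few [zs] in [X]. Modulo the product [M] of the normal closures of [[x, G]]
    for [x] in [xs ++ zs], the [zs] are central by construction and [C] by Wiegold's argument, so
    [G / M] is abelian. *)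
Lemma card_der1_le L : 0 < L -> r <= L -> m <= L -> #|G^`(1)| <= 2 ^ (10 * L ^ 9).
Proof.
move=> L0 rL mL.
pose E := ((r ^ 2 * ((r ^ r) ^ 2 * r ^ m)) ^ (r ^ 2))%N.
have [a Ga amax] : exists2 a, a \in G & forall g, g \in G -> #|g ^: G| <= #|a ^: G|.
  by exists [arg max_(g > 1 in G) #|g ^: G|]; case: arg_maxnP.
have /mem_expgs_seq[xs [xsm xsX] def_a] := subsetP GX a Ga.
have {}xsX : {subset xs <= X} by move=> x; apply: (allP xsX).
(* Taking whole classes makes the centraliser [D] of [Y] normal, so that [D * U] is a group. *)
pose Y := \bigcup_(x in [set x in xs]) x ^: G.
have cY : #|Y| <= r * m.
  apply: leq_trans (_ : #|[set x in xs]| * r <= _); last first.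
    by rewrite mulnC leq_mul2l -xsm cardsE card_size orbT.
  rewrite -sum_nat_const /Y; elim/big_rec2: _ => [|x k V xx IH]; first by rewrite cards0.
  rewrite (leq_trans (leq_card_setU _ _)) // leq_add // Xr //.
  by apply: xsX; rewrite inE in xx.
have YG : Y \subset G.
  apply/bigcupsP => x; rewrite inE => sx; apply: class_subG => //.
  exact: (subsetP sXG _ (xsX _ sx)).
have nY : G \subset 'N(Y).
  apply/subsetP => g Gg; rewrite inE; apply/subsetP => _ /imsetP[y /bigcupP[x sx xy] ->].
  by apply/bigcupP; exists x; rewrite // memJ_norm // (subsetP (class_norm x G)).
pose D := 'C_G(Y)%G.
have Dr : #|G : D| <= r ^ (r * m).
  apply: leq_trans (index_cent_le (n := r) _) _; last by rewrite leq_pexp2l.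
  by move=> y /bigcupP[x sx xy]; rewrite (class_eqP xy) Xr // xsX //; rewrite inE in sx.
have sDG : D \subset G := subsetIl _ _.
have nD : G \subset 'N(D) by rewrite normsI ?normG ?norms_cent.
have [us [usX us2 Gus]] := few_generators gX sDG.
have {us2}usm := exp2_le_inv (leq_trans us2 Dr).
pose U := <<[set x in us]>>%G.
have sUG : U \subset G.
  by rewrite gen_subG; apply/subsetP => u; rewrite inE => /usX; apply: (subsetP sXG).
have GDU : G \subset D * U.
  apply: subset_trans Gus _; rewrite -norm_joinEr ?(subset_trans sUG) //.
  by rewrite gen_subG subUset joing_subl (subset_trans (subset_gen _)) ?joing_subr.
(* [D] fixes [a], since it centralises every factor of [a]; only [U] moves it. *)
have aU : a ^: G = a ^: U.
  apply/eqP; rewrite eqEsubset [X in _ && X]imsetS // andbT.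
  apply/subsetP => _ /imsetP[_ /(subsetP GDU)/mulsgP[d u Dd Uu ->] ->].
  suff ad : a ^ d = a by rewrite conjgM ad memJ_class.
  rewrite def_a conjg_prod; apply: eq_big_seq => x sx.
  have : x \in Y.
    by apply/bigcupP; exists x; rewrite ?inE ?class_refl.
  by case/setIP: Dd => _ /centP cd /cd; rewrite /conjg => <-; rewrite mulKg.
pose C := 'C_G([set x in us])%G.
have Cr : #|G : C| <= r ^ (m * (r * (r * m))).
  apply: leq_trans (index_cent_le (n := r ^ m) _) _.
    by move=> x; rewrite inE => /usX Xx; apply/Gn/(subsetP sXG).
  rewrite -expnM leq_pexp2l // leq_mul2l cardsE; apply/orP; right.
  exact: leq_trans (card_size us) usm.
have sCG : C \subset G := subsetIl _ _.
have [zs [zsX zs2 Gzs]] := few_generators gX sCG.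
have {zs2}zsm := exp2_le_inv (leq_trans zs2 Cr).
have [|M [nM cM sM]] := @product_of_normal_subgroups G (class_diff_group G) E (xs ++ zs).
  move=> x; rewrite mem_cat => xz.
  have Xx : x \in X by case/orP: xz => [/xsX|/zsX].
  have Gx := subsetP sXG x Xx.
  split; [by rewrite gen_subG class_diffs_sub|exact: class_diff_group_norm|].
  by apply: card_class_diff_group => //; apply: Xr.
have xM x g : x \in xs ++ zs -> g \in G -> [~ x, g] \in M.
  by move=> sx Gg; apply: (subsetP (sM x sx)); apply: class_diff_commg.
have aM g : g \in G -> [~ a, g] \in M.
  move=> Gg; rewrite def_a.
  have : {subset xs <= xs} by [].
  elim: {-2}xs => [|x s IH] sxs; first by rewrite big_nil comm1g group1.
  rewrite big_cons commMgJ groupM //; last by apply: IH => y sy; rewrite sxs // inE sy orbT.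
  rewrite memJ_norm; first by rewrite xM // mem_cat sxs // mem_head.
  apply: (subsetP nM); rewrite big_seq; apply: group_prod => y sy.
  by apply/(subsetP sXG)/xsX/sxs; rewrite inE sy orbT.
have cM' : [~: [set x in zs] :|: C, G] \subset M.
  rewrite gen_subG; apply/subsetP => _ /imset2P[x g + Gg ->].
  rewrite inE => /orP[|Cx]; first by rewrite inE => zx; rewrite xM // mem_cat zx orbT.
  apply: (central_mod_of_max_class Ga sUG amax aU nM aM) => //.
  by rewrite /U /= cent_gen.
have sZG : [set x in zs] :|: C \subset G.
  rewrite subUset sCG andbT; apply/subsetP => x; rewrite inE => /zsX.
  exact: (subsetP sXG).
have abG : abelian (G / M).
  have eG : <<[set x in zs] :|: C>> = G by apply/eqP; rewrite eqEsubset Gzs gen_subG sZG.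
  rewrite /abelian -{1}eG quotient_gen ?(subset_trans sZG) // gen_subG.
  exact: quotient_cents2r cM'.
apply: leq_trans (subset_leq_card (der1_min nM abG)) _.
apply: leq_trans cM _; rewrite size_cat xsm.
apply: leq_trans (derived_bound_le (r := r) _ _ _ zsm) => //.
Qed.
End Neumann.

(* If [y] lies in [X ^+ (3i + 2)] but not in [X ^+ (3i + 1)], then [y *: X] is
   disjoint from [X ^+ (3i)], so the size grows by [#|X|] in three steps. *)
Lemma gen_sub_expgs (G : {group gT}) (X : {set gT}) K : X \subset G -> 1 \in X ->
  (forall x, x \in X -> x^-1 \in X) -> #|G| <= K * #|X| -> <<X>> \subset X ^+ (3 * K).
Proof.
move=> sXG X1 XV GK.
have sS j : X ^+ j \subset X ^+ j.+1 by rewrite expgS -{1}[X ^+ j]mul1g mulSg // sub1set.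
have sD j k : X ^+ j \subset X ^+ (j + k).
  by elim: k => [|k IH]; rewrite ?addn0 // addnS (subset_trans IH) // sS.
have XG j : X ^+ j \subset G.
  by elim: j => [|j IH]; rewrite ?expg0 ?sub1G // expgS mul_subG.
have grow i : (exists2 j, j <= 3 * i & X ^+ j.+1 \subset X ^+ j) \/
              i * #|X| < #|X ^+ (3 * i)|.
  elim: i => [|i [[j ji Xj]|IH]]; first by right; rewrite expg0 cards1.
    by left; exists j => //; lia.
  have [h|/subsetPn[y y2 y1]] := boolP (X ^+ (3 * i).+2 \subset X ^+ (3 * i).+1).
    by left; exists (3 * i).+1 => //; lia.
  right; have d : [disjoint X ^+ (3 * i) & y *: X].
    rewrite -setI_eq0; apply/eqP/setP => z; rewrite !inE; apply/negP => /andP[zi].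
    case/lcosetP => x Xx zyx; case/negP: y1.
    by rewrite expgSr -(mulgK x y) -zyx mem_mulg // XV.
  have -> : (3 * i.+1 = (3 * i).+3)%N by lia.
  apply: leq_trans (_ : #|X ^+ (3 * i) :|: y *: X| <= _).
    by rewrite cardsU (disjoint_setI0 d) cards0 subn0 card_lcoset mulSn; lia.
  apply: subset_leq_card; rewrite subUset; have := sD (3 * i)%N 3; rewrite addn3 => -> /=.
  rewrite expgSr; apply/subsetP => _ /lcosetP[x Xx ->]; exact: mem_mulg.
have [[j jK Xj]|] := grow K; last first.
  by rewrite ltnNge (leq_trans (subset_leq_card (XG _)) GK).
have Xk k : X ^+ k \subset X ^+ j.
  have [kj|/ltnW/subnKC <-] := leqP k j; first by rewrite -(subnKC kj) sD.
  elim: (k - j) => [|l IH]; rewrite ?addn0 // addnS expgS.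
  by apply: subset_trans (mulgS _ IH) _; rewrite -expgS.
have [k ->] := gen_expgs X.
have -> : 1 |: X = X by apply/setUidPr; rewrite sub1set.
by rewrite (subset_trans (Xk k)) // -(subnKC jK) sD.
Qed.

Lemma card_der1_gen_le (G : {group gT}) (X : {set gT}) K r L : X \subset G ->
    1 \in X -> (forall x, x \in X -> x^-1 \in X) -> #|G| <= K * #|X| ->
    (forall x, x \in X -> #|x ^: G| <= r) -> r <= L -> 3 * K <= L ->
  #|<<X>>^`(1)| <= 2 ^ (10 * L ^ 9).
Proof.
move=> sXG X1 XV GK Xr rL KL.
have r0 : 0 < r by apply: leq_trans (Xr 1 X1); rewrite class1G cards1.
apply: (@card_der1_le <<X>>%G X r (3 * K)) => //.
- exact: subset_gen.
- exact: gen_sub_expgs GK.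
- move=> x Xx; apply: leq_trans (Xr x Xx); apply: subset_leq_card.
  by apply: imsetS; rewrite gen_subG.
- exact: leq_trans r0 rL.
Qed.
End FiniteGroups.

From mathcomp Require Import all_classical all_reals all_analysis.
Import Order.TTheory GRing.Theory Num.Theory.

(** * Subgroups of finite index *)

Section InfiniteGroups.
Local Open Scope classical_set_scope.
Local Open Scope group_scope.
Variable G : groupType.
Implicit Types (H K : set G) (x y g : G).

Lemma subgroup1 H : is_subgroup H -> H 1. Proof. by case. Qed.
Lemma subgroupV H x : is_subgroup H -> H x -> H x^-1.
Proof. by case=> H1 HD Hx; rewrite -[_^-1]mul1g; apply: HD. Qed.
Lemma subgroupM H x y : is_subgroup H -> H x -> H y -> H (x * y).
Proof. by move=> sH Hx Hy; rewrite -[y]invgK; apply: sH.2 => //; apply: subgroupV. Qed.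
Lemma subgroupMl H x y : is_subgroup H -> H x -> H (x * y) -> H y.
Proof. by move=> sH Hx /(subgroupM sH (subgroupV sH Hx)); rewrite mulKg. Qed.
Lemma subgroupX H x n : is_subgroup H -> H x -> H (x ^+ n).
Proof.
move=> sH Hx; elim: n => [|n IH]; first by rewrite expg0; apply: subgroup1.
by rewrite expgS; apply: subgroupM.
Qed.
Lemma subgroupI H K : is_subgroup H -> is_subgroup K -> is_subgroup (H `&` K).
Proof.
move=> sH sK; split; first by split; apply: subgroup1.
by move=> x y [Hx Kx] [Hy Ky]; split; [apply: sH.2 | apply: sK.2].
Qed.

Lemma left_cosetE x H y : left_coset x H y <-> H (x^-1 * y).
Proof.
split; first by case=> h Hh <-; rewrite mulKg.
by move=> Hxy; exists (x^-1 * y); rewrite ?mulKVg.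
Qed.

(** A cover by at most [n] left cosets; allowing repetitions makes the notion stable under enlarging
    [H] or [n] and easy to intersect. *)
Definition index_le H n := exists s : seq G, (size s <= n)%N /\
  forall g, exists2 x, x \in s & H (x^-1 * g).

Definition finite_index H := exists n, index_le H n.

Lemma index_le_sub H K n : H `<=` K -> index_le H n -> index_le K n.
Proof.
move=> HK [s [sn cov]]; exists s; split=> // g.
by have [x sx /HK] := cov g; exists x.
Qed.

Lemma index_leI H K m n : is_subgroup H -> is_subgroup K ->
  index_le H m -> index_le K n -> index_le (H `&` K) (m * n).
Proof.
move=> sH sK [s [sm covs]] [t [tn covt]].
(* [f x y] is a point of [xH] and [yK] if they meet; the default 1 only serves pairs of disjoint
   cosets. *)
pose f x y := xget 1 [set z | H (x^-1 * z) /\ K (y^-1 * z)].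
exists [seq f x y | x <- s, y <- t]; split.
  by rewrite size_allpairs leq_mul.
move=> g; have [x sx Hx] := covs g; have [y ty Ky] := covt g.
exists (f x y); first by apply/allpairsP; exists (x, y).
have [Hf Kf] : H (x^-1 * f x y) /\ K (y^-1 * f x y).
  by rewrite /f; case: xgetP => [z _ //|/(_ g)]; case.
split; first by apply: (subgroupMl sH Hf); rewrite mulgA mulgK.
by apply: (subgroupMl sK Kf); rewrite mulgA mulgK.
Qed.

(** A covering list of least length is a transversal: of two representatives of one coset, one could
    be dropped. *)
Lemma index_le_eq H n : is_subgroup H -> index_le H n ->
  exists2 k, (k <= n)%N & index_eq H k.
Proof.
move=> sH Hn; have ex : exists k, `[< index_le H k >] by exists n; apply/asboolP.
case: (ex_minnP ex) => k /asboolP Hk kmin; exists k; first exact/kmin/asboolP.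
have [s [sk cov]] := Hk.
have szk : size s = k.
  by apply/eqP; rewrite eqn_leq sk kmin //; apply/asboolP; exists s.
pose r (i : 'I_k) := nth 1 s i.
have inj (i j : 'I_k) : H ((r i)^-1 * r j) -> i = j.
  move=> Hij; apply/eqP/negPn/negP => ij.
  suff : index_le H k.-1.
    move=> /asboolP/kmin; have := ltn_ord i; lia.
  exists [seq r l | l <- rem j (enum 'I_k)]; split.
    by rewrite size_map size_rem ?mem_enum // size_enum_ord.
  move=> g; have [_ /(nthP 1)[l ls <-] Hl] := cov g; rewrite szk in ls.
  have mr a : a != j -> r a \in [seq r l | l <- rem j (enum 'I_k)].
    by move=> aj; apply: map_f; rewrite mem_rem_uniq ?enum_uniq // inE aj mem_enum.
  have [lj|lj] := eqVneq (Ordinal ls) j; last by exists (r (Ordinal ls)); first exact: mr.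
  exists (r i); first exact: mr.
  have -> : (r i)^-1 * g = ((r i)^-1 * r j) * ((r j)^-1 * g) by rewrite mulgA mulgK.
  by apply: subgroupM => //; rewrite -lj.
exists r => g; have [_ /(nthP 1)[l ls <-] Hl] := cov g; rewrite szk in ls.
exists (Ordinal ls); split; first exact/left_cosetE.
move=> j /left_cosetE Hj; apply: inj.
have -> : (r (Ordinal ls))^-1 * r j = ((r (Ordinal ls))^-1 * g) * ((r j)^-1 * g)^-1.
  by rewrite invMg invgK mulgA mulgK.
by apply: sH.2.
Qed.

Lemma index_eq_le H n : index_eq H n -> index_le H n.
Proof.
case=> r rP; exists [seq r i | i <- enum 'I_n]; split.
  by rewrite size_map size_enum_ord.
move=> g; have [i [/left_cosetE Hi _]] := rP g.
by exists (r i) => //; apply: map_f; rewrite mem_enum.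
Qed.

(** The action on left cosets. As permutations compose from left to right, [f g] moves the coset of
    [r i] to that of [g^-1 * r i]; [i0] labels the coset [H] itself. *)
Lemma coset_perm_rep H k : is_subgroup H -> index_eq H k ->
  exists (f : G -> {perm 'I_k}) (i0 : 'I_k),
    (forall x y, f (x * y) = f x * f y) /\ (forall g, H g <-> f g i0 = i0).
Proof.
move=> sH [r rP].
have [c cP] : exists c : G -> 'I_k, forall x i, c x = i <-> H ((r i)^-1 * x).
  exists (fun x => projT1 (cid (rP x))) => x i; case: cid => j [/= /left_cosetE Hj uj].
  by split=> [<- //|Hi]; apply: uj; apply/left_cosetE.
have cE x y : H (x^-1 * y) -> c x = c y.
  move=> Hxy; apply/esym/cP.
  have -> : (r (c x))^-1 * y = (r (c x))^-1 * x * (x^-1 * y) by rewrite mulgA mulgK.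
  by apply: subgroupM => //; apply/cP.
have cI x y : c x = c y -> H (x^-1 * y).
  move=> cxy; have Hx : H ((r (c y))^-1 * x) by apply/cP.
  apply: (subgroupMl sH Hx); rewrite mulgA mulgK; exact/cP.
have cr i : c (r i) = i by apply/cP; rewrite mulVg; apply: subgroup1.
have Finj g : injective (fun i => c (g^-1 * r i)).
  by move=> i j /cI; rewrite invMg invgK mulgA mulgK => /cE; rewrite !cr.
exists (fun g => perm (@Finj g)), (c 1); split.
  move=> x y; apply/permP => i; rewrite permM !permE; apply: cE.
  rewrite !invMg !invgK -!mulgA mulKVg mulgA.
  have : c (x^-1 * r i) = c (r (c (x^-1 * r i))) by rewrite cr.
  by move/cI; rewrite invMg invgK -!mulgA.
have H1 : H (r (c 1)).
  have /cP : c 1 = c 1 by []. 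
  by move=> /(subgroupV sH); rewrite mulg1 invgK.
move=> g; rewrite permE -{2}[c 1]cr; split=> [Hg|/cI].
  apply: cE; rewrite invMg invgK -mulgA; apply: subgroupM => //; first exact: subgroupV.
  exact: subgroupM.
rewrite invMg invgK => h; have := subgroupM sH H1 h.
rewrite -mulgA mulKVg => /(subgroupM sH) /(_ (subgroupV sH H1)).
by rewrite mulgK.
Qed.

Lemma perm_rep1 k (f : G -> {perm 'I_k}) :
  (forall x y, f (x * y) = f x * f y) -> f 1 = 1.
Proof. by move=> fM; apply: (mulgI (f 1)); rewrite -fM !mulg1. Qed.

Lemma perm_repV k (f : G -> {perm 'I_k}) x :
  (forall x y, f (x * y) = f x * f y) -> f x^-1 = (f x)^-1.
Proof. by move=> fM; apply: (mulgI (f x)); rewrite -fM !mulgV perm_rep1. Qed.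

(** A subgroup of index [k] is a point stabiliser of a homomorphism to the permutations of [k]
    points, which is determined by its values on the generators. So [k], the point and these values
    form a finite index set. *)
Lemma finitely_many_subgroups n : finitely_generated G ->
  exists (I : finType) (F : I -> set G),
    forall K, is_subgroup K -> index_le K n -> exists i, K = F i.
Proof.
case=> s sG; pose m := size s.
pose I := {k : 'I_n.+1 & ('I_k * {ffun 'I_m -> {perm 'I_k}})%type}.
pose hom k (f : G -> {perm 'I_k}) (p : {ffun 'I_m -> {perm 'I_k}}) :=
  (forall x y, f (x * y) = f x * f y) /\ (forall j : 'I_m, f (nth 1 s j) = p j).
pose F (i : I) : set G := fun g => exists2 f : G -> {perm 'I_(tag i)},
  hom _ f (tagged i).2 & f g (tagged i).1 = (tagged i).1.
exists I, F => K sK /(index_le_eq sK)[k kn /(coset_perm_rep sK)[f [i0 [fM fK]]]].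
pose p := [ffun j : 'I_m => f (nth 1 s j)].
exists (@Tagged _ (Ordinal (kn : k < n.+1)%N)
  (fun k : 'I_n.+1 => ('I_k * {ffun 'I_m -> {perm 'I_k}})%type) (i0, p)).
apply/seteqP; split=> [g /fK fg | g [h [hM hp] hg]].
  by exists f => //; split=> // j; rewrite ffunE.
apply/fK; suff -> : f g = h g by [].
have sE : is_subgroup [set g | f g = h g].
  split; first by rewrite /= (perm_rep1 fM) (perm_rep1 hM).
  by move=> x y /= fx fy; rewrite fM hM (perm_repV _ fM) (perm_repV _ hM) fx fy.
suff : [set g | f g = h g] = [set: G] by move=> E; have : [set: G] g by []; rewrite -E.
apply: sG => // _ /(nthP 1)[j js <-].
by have := hp (Ordinal js); rewrite /= ffunE => ->.
Qed.

(** Schreier's lemma: [t] consists of those products [x * b * y^-1] lying in [H], with [x], [y] in a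
    list [w] of right coset representatives and [b] a generator, its inverse or 1. *)
Lemma fg_finite_index H n : finitely_generated G -> is_subgroup H -> index_le H n ->
  exists t : seq G, (forall x, x \in t -> H x) /\
    (forall K, is_subgroup K -> (forall x, x \in t -> K x) -> H `<=` K).
Proof.
case=> s sG sH [c [_ cov]].
pose w := [:: 1 & map (fun x => x^-1) c].
have wcov g : exists2 x, x \in w & H (g * x^-1).
  have [x cx Hx] := cov g^-1; exists x^-1; first by rewrite inE map_f ?orbT.
  by rewrite -[_ * _]invgK invMg; apply: subgroupV => //; rewrite invgK.
pose s' := s ++ map (fun x => x^-1) s.
pose t := [seq x <- [seq x * y^-1 | x <- [seq a * b | a <- w, b <- 1 :: s'], y <- w] | `[< H x >]].
exists t; split=> [x|]; first by rewrite mem_filter => /andP[/asboolP].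
have tP x b y : x \in w -> b \in 1 :: s' -> y \in w -> H (x * b * y^-1) -> x * b * y^-1 \in t.
  move=> wx sb wy Hx; rewrite mem_filter; apply/andP; split; first exact/asboolP.
  by apply/allpairsP; exists (x * b, y); split=> //; apply/allpairsP; exists (x, b).
move=> K sK tK h Hh.
pose L := H `&` K; have sL : is_subgroup L := subgroupI sH sK.
have tL x : x \in t -> L x.
  by move=> tx; split; [move: tx; rewrite mem_filter => /andP[/asboolP]|exact: tK].
(* The union [W] of the cosets [L * x], [x] in [w], contains 1 and is stable under right
   multiplication by generators and their inverses, so it is all of [G]. *)
pose W : set G := fun g => exists2 x, x \in w & L (g * x^-1).
have Ws g b : b \in s' -> W g -> W (g * b).
  move=> sb [x wx Lx]; have [y wy Hy] := wcov (x * b); exists y => //.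
  have -> : g * b * y^-1 = g * x^-1 * (x * b * y^-1) by rewrite !mulgA mulgVK.
  by apply: subgroupM => //; apply/tL/tP => //; rewrite inE sb orbT.
pose S : set G := fun a => forall g, W g -> W (g * a) /\ W (g * a^-1).
have SE : S = [set: G].
  apply: sG; last first.
    move=> a sa g Wg; split; apply: Ws => //; first by rewrite mem_cat sa.
    by rewrite mem_cat map_f ?orbT.
  split; first by move=> g Wg; rewrite invg1 mulg1.
  move=> x y Sx Sy g Wg; rewrite invMg invgK !mulgA; split.
    by have [/Sy[_ ?] _] := Sx g Wg.
  by have [/Sx[_ ?] _] := Sy g Wg.
have W1 : W 1 by exists 1; rewrite ?inE ?eqxx // invg1 mulg1; apply: subgroup1.
have : S h by rewrite SE.
move=> /(_ 1 W1)[]; rewrite mul1g => -[x wx [Hx Kx]] _.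
suff Kxx : K x by rewrite -(mulgVK x h); apply: subgroupM.
have Hxx : H x by rewrite -[x]invgK; apply: subgroupV => //; apply: (subgroupMl sH Hh).
(* Including 1 in both lists makes a representative that lies in [H] itself a member of [t]. *)
have := tP x 1 1 wx; rewrite invg1 !mulg1 => h1.
by apply/tK/h1; rewrite // inE eqxx.
Qed.

End InfiniteGroups.

(** * Residual finiteness *)

Section ResiduallyFinite.
Local Open Scope classical_set_scope.
Local Open Scope group_scope.
Variable G : groupType.
Implicit Types (B K : set G) (x y g a f : G).

Lemma is_subgroupMV K : K 1 -> (forall x y, K x -> K y -> K (x * y)) ->
  (forall x, K x -> K x^-1) -> is_subgroup K.
Proof. by move=> K1 KM KV; split=> // x y Kx Ky; apply/KM/KV. Qed.

(** Inside an abelian group this is the subgroup generated by [B] and [a ^+ i]; the integer exponent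
    is written as a difference [p - q] of naturals. *)
Definition extend_power B a i : set G :=
  fun f => exists p q b, B b /\ f * a ^+ (i * q) = b * a ^+ (i * p).

(** No positive power of [a] lies in [B], so the coset of [f] determines the exponent [p - q]. *)
Lemma extend_power_inj B a f b c p q p' q' : is_subgroup B ->
  (forall j, (0 < j)%N -> ~ B (a ^+ j)) -> B b -> B c ->
  f * a ^+ q = b * a ^+ p -> f * a ^+ q' = c * a ^+ p' -> (p + q' = p' + q)%N.
Proof.
move=> sB Ba.
suff le b' c' p1 q1 p2 q2 : B b' -> B c' -> f * a ^+ q1 = b' * a ^+ p1 ->
    f * a ^+ q2 = c' * a ^+ p2 -> (p1 + q2 <= p2 + q1)%N.
  move=> Bb Bc e1 e2; apply/eqP; rewrite eqn_leq.
  by rewrite (le _ _ _ _ _ _ Bb Bc e1 e2) (le _ _ _ _ _ _ Bc Bb e2 e1).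
move=> Bb Bc e1 e2; rewrite leqNgt; apply/negP => lt.
have e : b' * a ^+ (p1 + q2) = c' * a ^+ (p2 + q1).
  rewrite [in RHS]expgnDr mulgA -e2 -mulgA -expgnDr (addnC q2) expgnDr mulgA e1.
  by rewrite -mulgA -expgnDr.
apply: (Ba (p1 + q2 - (p2 + q1))%N); first by rewrite subn_gt0.
apply: (subgroupMl sB Bb).
have -> : b' * a ^+ (p1 + q2 - (p2 + q1)) = c'; last by [].
by apply: (mulIg (a ^+ (p2 + q1))); rewrite -mulgA -expgnDr subnK // ltnW.
Qed.

(** If [f] is in [B] times a power of [a], the exponent is unique, and it is nonzero when [f] is
    outside [B]. It is not a multiple of any [i] exceeding its absolute value. *)
Lemma extend_power_avoid B a (F : seq G) : is_subgroup B ->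
    (forall j, (0 < j)%N -> ~ B (a ^+ j)) -> (forall f, f \in F -> ~ B f) ->
  exists N, forall i, (N < i)%N -> forall f, f \in F -> ~ extend_power B a i f.
Proof.
move=> sB Ba; elim: F => [|f F IH] FB; first by exists 0%N.
have [|N NP] := IH; first by move=> g Fg; apply: FB; rewrite inE Fg orbT.
have Bf : ~ B f by apply: FB; rewrite mem_head.
suff [M MP] : exists M, forall i, (M < i)%N -> ~ extend_power B a i f.
  exists (maxn N M) => i; rewrite gtn_max => /andP[Ni Mi] g.
  by rewrite inE => /predU1P[->|/(NP i Ni)//]; apply: MP.
have [[i0 [p [q [b [Bb e]]]]]|no] := pselect (exists i0, extend_power B a i0 f); last first.
  by exists 0%N => i _ Ti; apply: no; exists i.
exists (i0 * p + i0 * q)%N => i iM [p' [q' [c [Bc e']]]].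
have := extend_power_inj sB Ba Bb Bc e e'.
have [lt|lt|pq] := ltngtP p' q'.
- have : (i * p' + i <= i * q')%N by rewrite -mulnSr leq_mul.
  lia.
- have : (i * q' + i <= i * p')%N by rewrite -mulnSr leq_mul.
  lia.
- by move=> _; apply: Bf; move: e'; rewrite pq => /mulIg ->.
Qed.

Section Abelian.
Variable A : set G.
Hypotheses (sA : is_subgroup A) (cA : forall x y, A x -> A y -> x * y = y * x).

Lemma extend_power_subgroup B a i : is_subgroup B -> B `<=` A -> A a ->
  is_subgroup (A `&` extend_power B a i).
Proof.
move=> sB BA Aa; have Aan n : A (a ^+ n) by apply: subgroupX.
apply: is_subgroupMV.
- split; first exact: subgroup1.
  by exists 0%N, 0%N, 1; split; [exact: subgroup1 | rewrite !mul1g].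
- move=> x y [Ax [p [q [b [Bb xe]]]]] [Ay [p' [q' [c [Bc ye]]]]]; split.
    exact: subgroupM.
  exists (p' + p)%N, (q' + q)%N, (c * b); split; first exact: subgroupM.
  rewrite !mulnDr !expgnDr -mulgA (mulgA y) ye (cA (Aan (i * p')%N) (Aan (i * p)%N)).
  have Ac := BA _ Bc.
  rewrite !mulgA (cA Ax Ac) -(mulgA c x) -(mulgA c) -[in LHS](mulgA x).
  rewrite (cA (Aan (i * p')%N) (Aan (i * q)%N)) (mulgA x) xe.
  by rewrite !mulgA -(mulgA (c * b)) (cA (Aan (i * p)%N) (Aan (i * p')%N)) mulgA.
- move=> x [Ax [p [q [b [Bb xe]]]]]; split; first exact: subgroupV.
  exists q, p, b^-1; split; first exact: subgroupV.
  apply: (mulgI b); apply: (mulgI x); rewrite mulVKg xe.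
  by rewrite !mulgA (cA Ax (BA _ Bb)) mulgK.
Qed.

(** If [a] had infinite order modulo [B], adjoining a high power of [a] would enlarge [B] and still
    avoid [F]. *)
Lemma maximal_avoiding_torsion B (F : seq G) : is_subgroup B -> B `<=` A ->
    (forall f, f \in F -> ~ B f) ->
    (forall K, is_subgroup K -> K `<=` A -> B `<=` K -> (forall f, f \in F -> ~ K f) ->
       K `<=` B) ->
  forall a, A a -> exists2 j, (0 < j)%N & B (a ^+ j).
Proof.
move=> sB BA FB Bmax a Aa; apply: contrapT => no.
have Ba j : (0 < j)%N -> ~ B (a ^+ j) by move=> j0 Bj; apply: no; exists j.
have [N NP] := extend_power_avoid sB Ba FB.
apply: (Ba N.+1) => //; apply: (Bmax (A `&` extend_power B a N.+1)).
- exact: extend_power_subgroup.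
- by move=> x [].
- move=> b Bb; split; first exact: BA.
  by exists 0%N, 0%N, b; split.
- by move=> f Ff [_]; apply: NP.
- split; first exact: subgroupX.
  exists 1%N, 0%N, 1; split; first exact: subgroup1.
  by rewrite muln0 mulg1 mul1g muln1.
Qed.

(** A finitely generated torsion abelian group is finite, applied to the quotient by [B] of the
    subgroup generated by [B] and [l]. *)
Lemma torsion_cover B (l : seq G) : is_subgroup B -> B `<=` A ->
    (forall a, A a -> exists2 j, (0 < j)%N & B (a ^+ j)) -> (forall x, x \in l -> A x) ->
  exists (K : set G) (c : seq G), [/\ is_subgroup K, B `<=` K, K `<=` A,
    (forall x, x \in l -> K x) & forall x, K x -> exists2 y, y \in c & B (y^-1 * x)].
Proof.
move=> sB BA tors; elim: l => [|a l IH] lA.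
  exists B, [:: 1]; split=> // x Bx; exists 1; first by rewrite inE.
  by rewrite invg1 mul1g.
have [|K [c [sK BK KA lK cK]]] := IH; first by move=> x lx; apply: lA; rewrite inE lx orbT.
have Aa : A a by apply: lA; rewrite mem_head.
have Aan n : A (a ^+ n) by apply: subgroupX.
have [j j0 Bj] := tors a Aa.
(* Natural exponents suffice: modulo [B] the inverse of [a] is [a ^+ j.-1]. *)
pose K' : set G := fun x => A x /\ exists e, K (x * a ^+ e).
exists K', [seq y * (a ^+ e)^-1 | y <- c, e <- iota 0 j]; split.
- apply: is_subgroupMV.
  + by split; [exact: subgroup1|exists 0%N; rewrite mulg1; apply: subgroup1].
  + move=> x y [Ax [e Ke]] [Ay [e' Ke']]; split; first exact: subgroupM.
    exists (e + e')%N; have -> : x * y * a ^+ (e + e') = x * a ^+ e * (y * a ^+ e').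
      by rewrite expgnDr !mulgA -(mulgA x y) (cA Ay (Aan e)) !mulgA.
    exact: subgroupM.
  + move=> x [Ax [e Ke]]; split; first exact: subgroupV.
    exists (j.-1 * e)%N.
    have -> : x^-1 * a ^+ (j.-1 * e) = (x * a ^+ e)^-1 * a ^+ j ^+ e.
      rewrite -expgnA -[in RHS](prednK j0) mulSn expgnDr mulgA; congr (_ * _).
      by rewrite (cA Ax (Aan e)) invMg mulgVK.
    by apply: (subgroupM sK (subgroupV sK Ke)); apply: (BK _ (subgroupX _ sB Bj)).
- by move=> b Bb; split; [exact: BA|exists 0%N; rewrite mulg1; exact: BK].
- by move=> x [].
- move=> x xl; split; first exact: lA.
  move: xl; rewrite inE => /predU1P[->|/lK Kx]; last by exists 0%N; rewrite mulg1.
  by exists j.-1; rewrite -expgS prednK //; apply: BK.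
- move=> x [Ax [e Ke]].
  have Ke' : K (x * a ^+ (e %% j)).
    have -> : x * a ^+ (e %% j) = x * a ^+ e * (a ^+ j ^+ (e %/ j))^-1.
      by rewrite {2}(divn_eq e j) addnC expgnDr mulnC expgnA !mulgA mulgK.
    by apply: subgroupM => //; apply: subgroupV => //; apply: (BK _ (subgroupX _ sB Bj)).
  have [y cy By] := cK _ Ke'.
  exists (y * (a ^+ (e %% j))^-1).
    by apply/allpairsP; exists (y, (e %% j)%N); split; rewrite //= mem_iota add0n ltn_mod j0.
  rewrite invMg invgK -mulgA; have -> // : a ^+ (e %% j) * (y^-1 * x) = y^-1 * (x * a ^+ (e %% j)).
  have Ay : A (y^-1 * x).
    by have := subgroupM sA (BA _ By) (subgroupV sA (Aan (e %% j)%N)); rewrite -!mulgA mulgV mulg1.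
  by rewrite (cA (Aan _) Ay) mulgA.
Qed.

(** Let [B] be maximal among the subgroups of [A] that avoid [F]. Then [A / B] is torsion, and [A]
    is finitely generated by Schreier's lemma, so [B] has finite index. *)
Lemma residually_finite n (F : seq G) : finitely_generated G -> index_le A n ->
    (forall f, f \in F -> f <> 1) ->
  exists B, [/\ is_subgroup B, B `<=` A, finite_index B & forall f, f \in F -> ~ B f].
Proof.
move=> fg An F1.
pose P (B : set G) := [/\ B = set0 \/ is_subgroup B, B `<=` A & forall f, f \in F -> ~ B f].
have [|B [[sB0 BA FB] Bmax]] := @Zorn_bigcup _ P.
  move=> C CP tot; split.
  - have [[B CB [x Bx]]|no] := pselect (exists2 B, C B & B !=set0); last first.
      left; apply/seteqP; split=> // x [B CB Bx]; apply: no; exists B => //; by exists x.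
    have sub D z : C D -> D z -> is_subgroup D.
      by move=> /CP[[-> //|//]].
    right; split; first by exists B => //; apply: subgroup1; apply: sub Bx.
    move=> y z [D CD Dy] [E CE Ez].
    have [DE|ED] := tot _ _ CD CE.
      by exists E => //; apply: (sub E z CE Ez).2 => //; apply: DE.
    by exists D => //; apply: (sub D y CD Dy).2 => //; apply: ED.
  - by move=> x [B /CP[_ BA _] /BA].
  - by move=> f Ff [B /CP[_ _ FB] /FB]; apply.
have sB : is_subgroup B.
  case: sB0 => // B0; exfalso; apply: (Bmax [set 1]).
    by rewrite B0; split=> // /(_ 1); apply.
  split.
  - by right; split=> // x y -> ->; rewrite mulgV.
  - by move=> x ->; apply: subgroup1.
  - by move=> f Ff /= f1; apply: (F1 f).
exists B; split=> //.
have tors : forall a, A a -> exists2 j, (0 < j)%N & B (a ^+ j).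
  apply: (maximal_avoiding_torsion sB BA FB) => K sK KA BK FK.
  apply: contrapT => nKB; apply: (Bmax K); first by split.
  by split=> //; right.
have [l [lA lgen]] := fg_finite_index fg sA An.
have [K [c [sK BK KA lK cK]]] := torsion_cover sB BA tors lA.
have [s [_ scov]] := An.
exists (size [seq x * y | x <- s, y <- c]), [seq x * y | x <- s, y <- c]; split=> // g.
have [x sx Ax] := scov g; have [y cy By] := cK _ (lgen K sK lK _ Ax).
by exists (x * y); [apply/allpairsP; exists (x, y) | rewrite invMg -mulgA].
Qed.
End Abelian.
End ResiduallyFinite.

(** * Elements with large centralisers *)

Section LargeCentralizers.
Local Open Scope classical_set_scope.
Local Open Scope group_scope.
Variable G : groupType.
Implicit Types (H K S : set G) (x y g : G).

Definition centralizer S : set G := [set x | forall y, S y -> x * y = y * x].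

Lemma centralizer_subgroup S : is_subgroup (centralizer S).
Proof.
apply: is_subgroupMV => [y _|x y cx cy z Sz|x cx z Sz]; first by rewrite mul1g mulg1.
  by rewrite -mulgA (cy z Sz) !mulgA (cx z Sz).
by apply: (mulgI x); rewrite mulVKg mulgA (cx z Sz) mulgK.
Qed.

Definition generated S : set G := [set g | forall H, is_subgroup H -> S `<=` H -> H g].

Lemma generated_subgroup S : is_subgroup (generated S).
Proof.
split=> [H sH _|x y Sx Sy H sH SH]; first exact: subgroup1.
by apply: sH.2; [apply: Sx|apply: Sy].
Qed.

Lemma sub_generated S : S `<=` generated S.
Proof. by move=> x Sx H _; apply. Qed.

Lemma generated_normal S : (forall g h, S h -> S (g^-1 * h * g)) ->
  is_normal (generated S).
Proof.
move=> nS; split; first exact: generated_subgroup.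
move=> g h Sh; suff : [set y | generated S (g^-1 * y * g)] h by [].
apply: Sh => [|y Sy]; last by apply: sub_generated; apply: nS.
have sS := generated_subgroup S.
split=> [|x y /= Sx Sy]; first by rewrite /= mulg1 mulVg; apply: subgroup1.
have -> : g^-1 * (x * y^-1) * g = (g^-1 * x * g) * (g^-1 * y * g)^-1.
  by rewrite !invMg invgK !mulgA mulgK.
exact: sS.2.
Qed.

Definition derived S := generated [set z | exists x y, [/\ S x, S y & z = x^-1 * y^-1 * x * y]].

Lemma derived_normal S : is_normal S -> is_normal (derived S).
Proof.
move=> [sS nS]; apply: generated_normal => g _ [x [y [Sx Sy ->]]].
exists (g^-1 * x * g), (g^-1 * y * g); split; [exact: nS|exact: nS|].
by rewrite !invMg !invgK !mulgA !mulgK.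
Qed.

Lemma derived_sub S : is_subgroup S -> derived S `<=` S.
Proof.
move=> sS z; apply=> // _ [x [y [Sx Sy ->]]].
by apply: subgroupM => //; apply: subgroupM => //; apply: subgroupM => //; apply: subgroupV.
Qed.

(* When [G] is finitely generated this is, up to finitely many subgroups of
   infinite index, the set of elements with at most [r] conjugates; unlike the
   latter it is a finite union of subgroups of finite index. *)
Definition small_class r : set G := [set x | exists K,
  [/\ is_subgroup K, index_le K r, finite_index (centralizer K) & centralizer K x]].

Lemma small_classJ r g x : small_class r x -> small_class r (g^-1 * x * g).
Proof.
have conjI y h : (h * y^-1 * h^-1)%g = (h * y * h^-1)^-1 by rewrite !invMg invgK mulgA.
pose J S : set G := [set y | S (g * y * g^-1)].
have sJ S : is_subgroup S -> is_subgroup (J S).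
  move=> sS; split=> [|y z Sy Sz]; first by rewrite /J /= mulg1 mulgV; apply: subgroup1.
  rewrite /J /=; have -> : g * (y * z^-1) * g^-1 = (g * y * g^-1) * (g * z * g^-1)^-1.
    by rewrite -conjI !mulgA mulgVK.
  exact: sS.2.
have iJ S n : index_le S n -> index_le (J S) n.
  move=> [s [sn cov]]; exists [seq g^-1 * y * g | y <- s]; rewrite size_map; split=> // h.
  have [y sy Sy] := cov (g * h * g^-1); exists (g^-1 * y * g); first exact: map_f.
  by rewrite /J /= !invMg invgK !mulgA mulgV mul1g; move: Sy; rewrite !mulgA.
move=> [K [sK Kr [n cn] cx]]; exists (J K); split; [exact: sJ|exact: iJ| |].
  exists n; apply: index_le_sub (iJ _ _ cn) => y cy z Kz.
  have := cy _ Kz; rewrite !mulgA !mulgVK => /mulIg.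
  by rewrite -!mulgA => /mulgI.
move=> y Ky; apply: (mulgI g); apply: (mulIg g^-1).
by move: (cx _ Ky); rewrite !mulgA mulgK mulgV mul1g.
Qed.

Definition perm_image k (f : G -> {perm 'I_k}) S : {set {perm 'I_k}} :=
  finset (fun p => `[< exists2 x, S x & f x = p >]).

Lemma perm_imageP k (f : G -> {perm 'I_k}) S p :
  p \in perm_image f S <-> exists2 x, S x & f x = p.
Proof. by rewrite finset.in_set; split=> /asboolP. Qed.

Lemma finite_of_uniq S m : (forall l : seq G, uniq l -> (forall x, x \in l -> S x) ->
  (size l <= m)%N) -> exists s : seq G, (forall h, S h -> h \in s) /\ (size s <= m)%N.
Proof.
move=> lm; pose P n := `[< exists l : seq G, [/\ uniq l, forall x, x \in l -> S x & size l = n] >].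
have P0 : exists n, P n by exists 0%N; apply/asboolP; exists [::].
have Pm n : P n -> (n <= m)%N by move=> /asboolP[l [ul lS <-]]; apply: lm.
case: (ex_maxnP P0 Pm) => n /asboolP[l [ul lS ln]] nmax; exists l; split; last exact: lm.
move=> h Sh; apply/negPn/negP => hl.
suff /nmax : P n.+1 by rewrite ltnn.
apply/asboolP; exists (h :: l); split; rewrite /= ?hl ?ln //.
by move=> x; rewrite inE => /predU1P[->|/lS].
Qed.

(** It suffices to bound a duplicate-free list [l] in the derived subgroup. Residual finiteness
    gives a finite-index [B] missing all quotients of distinct members of [l], so the action on its
    cosets is injective on [l] and the bound for finite groups applies to the image. *)
Lemma card_derived_small_class (r K L : nat) : finitely_generated G -> small_class r 1 ->
    (forall k (f : G -> {perm 'I_k}), (forall x y, f (x * y) = f x * f y) ->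
       (#|perm_image f setT| <= K * #|perm_image f (small_class r)|)%N) ->
    (r <= L)%N -> (3 * K <= L)%N ->
  exists s : seq G, (forall h, derived (generated (small_class r)) h -> h \in s) /\
    (size s <= 2 ^ (10 * L ^ 9))%N.
Proof.
move=> fg [K0 [sK0 K0r [n cn] _]] dens rL KL; apply: finite_of_uniq => l ul lD.
(* The witness for the identity provides an abelian subgroup of finite index. *)
pose A := K0 `&` centralizer K0.
have sA : is_subgroup A := subgroupI sK0 (centralizer_subgroup K0).
have cA x y : A x -> A y -> x * y = y * x by move=> [_ cx] [Ky _]; apply: cx.
have An := index_leI sK0 (centralizer_subgroup K0) K0r cn.
pose F := [seq z <- [seq x^-1 * y | x <- l, y <- l] | z != 1].
have F1 z : z \in F -> z <> 1 by rewrite mem_filter => /andP[/eqP].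
have [B [sB _ [m Bm] BF]] := residually_finite sA cA fg An F1.
have [k _ /(coset_perm_rep sB)[f [i0 [fM fB]]]] := index_le_eq sB Bm.
have f1 := perm_rep1 fM; have fV x := perm_repV x fM.
have finj : {in l &, injective f}.
  move=> x y lx ly fxy; have : f (x^-1 * y) = 1 by rewrite fM fV fxy mulVg.
  move=> f1'; have Bxy : B (x^-1 * y) by apply/fB; rewrite f1' perm1.
  apply: contrapT => nxy; have xy : x^-1 * y != 1.
    by apply/eqP => e; apply: nxy; apply: (mulgI x^-1); rewrite mulVg e.
  case: (BF (x^-1 * y)) => //; rewrite mem_filter xy; by apply/allpairsP; exists (x, y).
have grG : group_set (perm_image f setT).
  apply/group_setP; split; first by apply/perm_imageP; exists 1.
  move=> _ _ /perm_imageP[x _ <-] /perm_imageP[y _ <-].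
  by apply/perm_imageP; exists (x * y).
pose fG := Group grG; pose X := perm_image f (small_class r).
have XG : X \subset fG.
  by apply/fintype.subsetP => _ /perm_imageP[x _ <-]; apply/perm_imageP; exists x.
have X1 : 1 \in X.
  apply/perm_imageP; exists 1 => //; exists K0; split=> //; first by exists n.
  exact: subgroup1 (centralizer_subgroup _).
have XV p : p \in X -> p^-1 \in X.
  move=> /perm_imageP[x [K' [sK' K'r K'n cx]] <-]; rewrite -fV.
  apply/perm_imageP; exists x^-1 => //; exists K'; split=> //.
  exact: subgroupV (centralizer_subgroup _) cx.
(* As [x] commutes with [K'], coset representatives of [K'] already produce all its conjugates. *)
have Xr p : p \in X -> #|p ^: fG| <= r.
  move=> /perm_imageP[x [K' [sK' [s [sr scov]] _ cx]] <-].
  apply: leq_trans sr; rewrite -(size_map (fun y => f (y * x * y^-1))).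
  apply: leq_trans (card_size _); apply: subset_leq_card.
  apply/fintype.subsetP => _ /imsetP[_ /perm_imageP[g _ <-] ->].
  have [y sy Ky] := scov g^-1; apply/mapP; exists y => //.
  rewrite /conjg -fV -!fM; congr (f _).
  have [u Ku ->] : exists2 u, K' u & g = u^-1 * y^-1.
    by exists (y^-1 * g^-1); rewrite // invMg !invgK mulgK.
  by rewrite invMg !invgK -!mulgA (mulgA x) (cx _ (subgroupV sK' Ku)) -!mulgA mulVKg.
have bound := card_der1_gen_le XG X1 XV (dens k f fM) Xr rL KL.
have fgen x : generated (small_class r) x -> f x \in <<X>>.
  move=> gx; have : [set x | f x \in <<X>>] x; last by [].
  apply: gx => [|y Xy]; last by apply: mem_gen; apply/perm_imageP; exists y.
  by split=> [|y z /= fy fz]; rewrite /= ?f1 // fM fV groupM ?groupV.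
have fder x : derived (generated (small_class r)) x -> f x \in <<X>>^`(1).
  move=> gx; have : [set x | f x \in <<X>>^`(1)] x; last by [].
  apply: gx => [|_ [y [z [/fgen Xy /fgen Xz ->]]]].
    by split=> [|y z /= fy fz]; rewrite /= ?f1 // fM fV groupM ?groupV.
  rewrite /= !fM !fV -!mulgA; exact: mem_commg.
apply: leq_trans bound; rewrite -(size_map f).
have /card_uniqP <- : uniq (map f l) by rewrite map_inj_in_uniq.
by apply/subset_leq_card/fintype.subsetP => _ /mapP[x lx ->]; apply: fder; apply: lD.
Qed.
End LargeCentralizers.

(** * Commuting probability and index *)

Section ProbabilityMass.
Local Open Scope classical_set_scope.
Local Open Scope ring_scope.
Variables (R : realType) (G : groupType).
Implicit Types (A B S : set G) (mu : G -> R).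

Lemma esumZl_le (T : choiceType) (D : set T) (c : R) (f : T -> R) :
  0 <= c -> (forall x, 0 <= f x) ->
  (\esum_(x in D) (c * f x)%:E <= c%:E * \esum_(x in D) (f x)%:E)%E.
Proof.
move=> c0 f0; apply: ge_ereal_sup => _ [X [finX XD] <-].
under eq_fsbigr do rewrite EFinM.
rewrite -ge0_mule_fsumr; last by move=> i; rewrite lee_fin.
by apply: lee_wpmul2l; rewrite ?lee_fin //; apply: esum_ge; exists X.
Qed.

Section Fixed.
Variable mu : G -> R.
Hypothesis mu_prob : is_prob mu.
Let mu0 x : 0 <= mu x := mu_prob.1 x.

Let esum_mu_ge0 A : (0 <= \esum_(x in A) (mu x)%:E)%E.
Proof. by apply: esum_ge0 => x _; rewrite lee_fin. Qed.

Let esum_muD A : (\esum_(x in A) (mu x)%:E + \esum_(x in ~` A) (mu x)%:E = 1)%E.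
Proof.
have := mu_prob.2; rewrite (esumID A) ?setTI //.
by move=> x _; rewrite lee_fin.
Qed.

Lemma pmeasE A : (pmeas mu A)%:E = (\esum_(x in A) (mu x)%:E)%E.
Proof.
rewrite fineK // ge0_fin_numE //; apply: le_lt_trans (ltry 1).
by rewrite -(esum_muD A) leeDl.
Qed.

Lemma pmeas_ge0 A : 0 <= pmeas mu A.
Proof. by rewrite -lee_fin pmeasE. Qed.

Lemma pmeasC A : pmeas mu A + pmeas mu (~` A) = 1.
Proof. by apply: EFin_inj; rewrite EFinD !pmeasE. Qed.

Lemma pmeas_le1 A : pmeas mu A <= 1.
Proof. by rewrite -(pmeasC A) lerDl pmeas_ge0. Qed.

Lemma pmeasS A B : A `<=` B -> pmeas mu A <= pmeas mu B.
Proof.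
move=> AB; rewrite -lee_fin !pmeasE.
rewrite (esumID A B); last by move=> x _; rewrite lee_fin.
by rewrite (setIidr AB) leeDl // esum_ge0 // => x _; rewrite lee_fin.
Qed.

Lemma pmeasU_le A B : pmeas mu (A `|` B) <= pmeas mu A + pmeas mu B.
Proof.
rewrite -lee_fin EFinD !pmeasE (esumID A (A `|` B)); last first.
  by move=> x _; rewrite lee_fin.
apply: leeD; rewrite -?pmeasE lee_fin; apply: pmeasS; first by move=> x [].
by move=> x [[]].
Qed.

Lemma pmeas_bigcup_le (I : eqType) (s : seq I) (F : I -> set G) (b : R) :
  (forall i, i \in s -> pmeas mu (F i) <= b) ->
  pmeas mu [set x | exists2 i, i \in s & F i x] <= (size s)%:R * b.
Proof.
elim: s => [|i s IH] Fb.
  rewrite mul0r (_ : [set x | _] = set0); first by rewrite /pmeas esum_set0.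
  by apply/seteqP; split=> // x [].
apply: le_trans (_ : pmeas mu (F i `|` [set x | exists2 i, i \in s & F i x]) <= _).
  apply: pmeasS => x [j]; rewrite inE => /predU1P[->|js] Fx; first by left.
  by right; exists j.
apply: le_trans (pmeasU_le _ _) _; rewrite /= -natr1 mulrDl mul1r addrC.
apply: lerD; last by rewrite Fb ?mem_head.
by apply: IH => j js; rewrite Fb // inE js orbT.
Qed.

(** Condition on the first coordinate: the chance of commuting with it is at most 1 on [S] and at
    most [c] off [S]. *)
Lemma dc_le S (c : R) : 0 <= c ->
  (forall x, ~ S x -> pmeas mu [set y | (x * y = y * x)%g] <= c) ->
  (dc mu <= (pmeas mu S + c * (1 - pmeas mu S))%:E)%E.
Proof.
move=> c0 Sc; pose C (x : G) := [set y : G | (x * y = y * x)%g].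
have -> : dc mu = (\esum_(x in [set: G]) \esum_(y in C x) (mu x * mu y)%:E)%E.
  rewrite esum_esum; last by move=> x y _ _; rewrite lee_fin mulr_ge0.
  by rewrite /dc; congr esum; apply/seteqP; split=> [[x y]|[x y] []].
rewrite (esumID S); last first.
  by move=> x _; apply: esum_ge0 => y _; rewrite lee_fin mulr_ge0.
rewrite !setTI EFinD.
have mc x : (\esum_(y in C x) (mu x * mu y)%:E <= (mu x * pmeas mu (C x))%:E)%E.
  by apply: le_trans (esumZl_le _ _ _) _; rewrite // EFinM pmeasE.
apply: leeD.
  rewrite pmeasE; apply: le_esum => x _; apply: le_trans (mc x) _.
  by rewrite lee_fin ler_piMr // pmeas_le1.
have -> : 1 - pmeas mu S = pmeas mu (~` S) by rewrite -(pmeasC S) addrC addKr.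
apply: le_trans (_ : \esum_(x in ~` S) (c * mu x)%:E <= _)%E.
  apply: le_esum => x Sx; apply: le_trans (mc x) _.
  by rewrite lee_fin mulrC ler_wpM2r // Sc.
by rewrite EFinM pmeasE; apply: esumZl_le.
Qed.
End Fixed.

Lemma limn_esup_frequently (u : nat -> \bar R) (b e : R) N : 0 < e ->
  (b%:E <= limn_esup u)%E -> exists n, (N <= n)%N /\ ((b - e)%:E <= u n)%E.
Proof.
move=> e0 bu; apply: contrapT => no.
suff : (limn_esup u <= (b - e)%:E)%E.
  by move=> /(le_trans bu); rewrite lee_fin; lra.
apply: ge_ereal_inf; exists (ereal_sup (u @` [set n | (N <= n)%N])).
  by exists [set n | (N <= n)%N] => //; exists N.
apply: ge_ereal_sup => _ [n /= Nn <-]; rewrite leNgt; apply/negP => /ltW h.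
by apply: no; exists n.
Qed.
End ProbabilityMass.

(** * Cosets of centralisers and of the centre *)

Section Pigeonhole.
Local Open Scope classical_set_scope.
Local Open Scope group_scope.
Variable G : groupType.
Implicit Types (H S : set G) (x y g : G).

Lemma index_le_pigeonhole H n (l : seq G) : is_subgroup H -> index_le H n ->
  (n < size l)%N -> exists i j, [/\ (i < j)%N, (j < size l)%N & H ((nth 1 l i)^-1 * nth 1 l j)].
Proof.
move=> sH [s [sn cov]] nl.
have [c cP] : exists c : G -> G, forall g, c g \in s /\ H ((c g)^-1 * g).
  exists (fun g => xget 1 [set x | x \in s /\ H (x^-1 * g)]) => g.
  have [x sx Hx] := cov g.
  by case: xgetP => [y _ //|/(_ x)]; case.
have /(uniqPn 1) : ~~ uniq (map c l).
  apply/negP => ul; have := uniq_leq_size ul; rewrite size_map.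
  move=> /(_ s) h; have := leq_trans (h _) sn; rewrite leqNgt nl => /(_ _)/negP; apply=> //.
  by move=> _ /mapP[x _ ->]; have [] := cP x.
move=> [i [j [ij jl]]]; rewrite size_map in jl; have il := ltn_trans ij jl.
rewrite !(nth_map 1) // => cij; exists i, j; split=> //.
have [_ Hi] := cP (nth 1 l i); have [_ Hj] := cP (nth 1 l j).
by apply: (subgroupMl sH Hi); rewrite cij mulgA mulgK.
Qed.

Lemma index_le_mono H m n : (m <= n)%N -> index_le H m -> index_le H n.
Proof. by move=> mn [s [sm cov]]; exists s; split=> //; apply: leq_trans mn. Qed.

Lemma centralizer1_subgroup x : is_subgroup [set y | x * y = y * x].
Proof.
split=> [|y z /= xy xz]; first by rewrite /= mul1g mulg1.
rewrite mulgA xy -!mulgA; congr (y * _).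
by apply: (mulIg z); rewrite -!mulgA mulVg mulg1 xz mulKg.
Qed.

Lemma centre_subgroup : is_subgroup (@centre G).
Proof.
have -> : @centre G = centralizer setT by apply/seteqP; split=> [z cz g _|z cz g]; apply: cz.
exact: centralizer_subgroup.
Qed.

(** For non-commuting [x] and [y] the elements 1, [x], [y], [x * y] lie in four different cosets of
    the centre. *)
Lemma abelian_of_centre_index_le3 : index_le (@centre G) 3 -> is_abelian G.
Proof.
move=> Z3 x y; apply: contrapT => xy.
have [//|i [j [ij]]] := index_le_pigeonhole (l := [:: 1; x; y; x * y]) centre_subgroup Z3.
move=> /= j4 Zij; apply: xy.
move: i j ij j4 Zij => [|[|[|i]]] [|[|[|[|j]]]] //= _ _.
- by rewrite invg1 mul1g => /(_ y).
- by rewrite invg1 mul1g => /(_ x).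
- rewrite invg1 mul1g => /(_ x); rewrite -mulgA => /mulgI ->; by [].
- by move=> /(_ x); rewrite -mulgA => /(congr1 (fun z => x * z)); rewrite !mulVKg => ->.
- by rewrite mulKg => /(_ x) ->.
- move=> /(_ y); rewrite -!mulgA mulVKg => /(congr1 (fun z => y * z)).
  by rewrite mulVKg !mulgA => /mulIg.
Qed.
End Pigeonhole.

(** * Commuting probability and the index of the centre *)

Section UniformIndex.
Local Open Scope classical_set_scope.
Local Open Scope ring_scope.
Variables (R : realType) (G : groupType) (M : nat -> G -> R).
Hypothesis M_prob : forall n, is_prob (M n).
Hypothesis M_index : measures_index_uniformly M.
Implicit Types (H S : set G).

Lemma inv_indexP H : (inv_index R H = 0 /\ forall k, ~ index_eq H k) \/
  exists2 k, index_eq H k & inv_index R H = k%:R^-1.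
Proof.
rewrite /inv_index; case: pselect => [P|nP].
  by right; exists (projT1 (cid P)); first exact: (projT2 (cid P)).
by left; split=> // k Hk; apply: nP; exists k.
Qed.

Lemma inv_index_le H m : (forall k, index_eq H k -> (m < k)%N) ->
  inv_index R H <= m.+1%:R^-1.
Proof.
move=> Hm; have [[-> _]|[k /Hm mk ->]] := inv_indexP H; first by rewrite invr_ge0.
by rewrite lef_pV2 ?posrE ?ltr0n ?ler_nat // (leq_trans _ mk).
Qed.

Lemma pmeas_coset_lt e : 0 < e -> exists N, forall n, (N <= n)%N ->
  forall x H, is_subgroup H -> pmeas (M n) (left_coset x H) < inv_index R H + e.
Proof.
move=> /M_index[N NP]; exists N => n Nn x H sH.
by have := NP n Nn x H sH; rewrite ltr_norml => /andP[_]; rewrite ltrBlDr addrC.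
Qed.

Lemma left_coset1 H : left_coset 1%g H = H.
Proof.
by apply/seteqP; split=> x; rewrite left_cosetE invg1 mul1g.
Qed.

(** Off [S] centralisers have index at least [r.+1], hence mass at most [r.+1%:R^-1 + e / 2]; the
    other half of [e] is lost in passing from the limsup to a single [n]. *)
Lemma dcM_frequently S (b e : R) r N : (b%:E <= dcM M)%E -> 0 < e ->
    (forall x, ~ S x -> ~ index_le [set y | (x * y = y * x)%g] r) ->
  exists n, (N <= n)%N /\
    b - e <= pmeas (M n) S + r.+1%:R^-1 * (1 - pmeas (M n) S).
Proof.
move=> bM e0 Sr; have e2 : 0 < e / 2 by lra.
have [N1 NP] := pmeas_coset_lt e2.
have [n [nN bn]] := limn_esup_frequently (maxn N N1) e2 bM.
move: nN; rewrite geq_max => /andP[Nn N1n]; exists n; split=> //.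
have := dc_le (M_prob n) (S := S) (c := r.+1%:R^-1 + e / 2) _ _.
set p := pmeas (M n) S => h.
have p0 : 0 <= p := pmeas_ge0 (M_prob n) S.
suff : ((b - e / 2)%:E <= (p + (r.+1%:R^-1 + e / 2) * (1 - p))%:E)%E.
  rewrite lee_fin mulrDl; set c := _ * (1 - p).
  have : e / 2 * p >= 0 by rewrite mulr_ge0 // ltW.
  rewrite mulrBr mulr1; set d := e / 2 * p; lra.
apply: le_trans bn (h _ _) => [|x Sx]; first by rewrite addr_ge0 // ltW.
have sC := centralizer1_subgroup x.
have := NP n N1n 1%g _ sC; rewrite left_coset1 => /ltW/le_trans; apply.
rewrite lerD2r; apply: inv_index_le => k Ck; rewrite ltnNge; apply/negP => kr.
by apply: (Sr x Sx); apply: index_le_mono kr _; apply: index_eq_le.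
Qed.

Lemma dcM_le1 (b : R) : (b%:E <= dcM M)%E -> b <= 1.
Proof.
move=> bM; apply/ler_addgt0Pr => e e0.
have [x /(_ Logic.I)//|n [_]] := dcM_frequently (S := setT) (r := 0) 0 bM e0.
have := pmeas_le1 (M_prob n) setT; rewrite invr1; lra.
Qed.

Lemma index_of_inv_index H (c : R) : 0 < c -> c <= inv_index R H ->
  exists2 k, index_eq H k & k%:R * c <= 1.
Proof.
move=> c0 cH; have [[h _]|[k Hk h]] := inv_indexP H; first by move: cH; rewrite h; lra.
exists k => //; move: cH; rewrite h; case: k {Hk h} => [|k] ch; first by rewrite mul0r.
by rewrite -ler_pdivlMl ?ltr0n // mulr1.
Qed.

(** Off the centre centralisers have index at least 2, so if the centre has mass [p] then
    [1 / 2 + eps] is at most [(1 + p) / 2] up to small errors, and [p] tends to the inverse index.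
    The factor 2 in the result is what the threshold 5/8 relies on. *)
Lemma centre_index (eps : R) : 0 < eps -> ((1 / 2 + eps)%:E <= dcM M)%E ->
  exists2 k, index_eq (@centre G) k & k%:R * (2 * eps) <= 1.
Proof.
move=> eps0 bM; apply: index_of_inv_index; first by lra.
apply/ler_addgt0Pr => e e0; have e3 : 0 < e / 3 by lra.
have [N NP] := pmeas_coset_lt e3.
have [x Zx C1|n [Nn]] := dcM_frequently (S := @centre G) (r := 1) N bM e3.
  have sC := centralizer1_subgroup x; apply: Zx => g.
  (* If the centraliser had index 1, then 1 and [g] would share a coset of it, so [g] would commute
     with [x]. *)
  have [//|i [j [ij]]] := index_le_pigeonhole (l := [:: 1; g]%g) sC C1.
  by case: i j ij => [|i] [|[|j]] //= _ _; rewrite invg1 mul1g.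
have := NP n Nn 1%g _ (@centre_subgroup G); rewrite left_coset1.
set p := pmeas _ _; rewrite (_ : 2%:R^-1 = 1 / 2 :> R); last by lra.
lra.
Qed.
End UniformIndex.

(** * The mass of the elements with large centralisers *)

Section LargeMeasure.
Local Open Scope classical_set_scope.
Local Open Scope ring_scope.
Variables (R : realType) (G : groupType) (M : nat -> G -> R).
Hypothesis M_prob : forall n, is_prob (M n).
Hypothesis M_index : measures_index_uniformly M.
Implicit Types (H S : set G).

Lemma inv_index_infinite H : ~ finite_index H -> inv_index R H = 0.
Proof.
move=> nH; have [[->]//|[k /index_eq_le Hk _]] := inv_indexP R H.
by case: nH; exists k.
Qed.

Section FinitelyGenerated.
Variables (alpha : R) (r : nat).
Hypothesis G_fg : finitely_generated G.
Hypothesis alphaM : (alpha%:E <= dcM M)%E.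

(** If the centraliser [K] of [x] has index at most [r], then [x] is in [small_class r] or in the
    centraliser of [K], of infinite index. Finitely many [K] occur, so the latter have total mass at
    most [e / 2]. *)
Lemma small_class_frequently (e : R) N : 0 < e ->
  exists n, (N <= n)%N /\ alpha - r.+1%:R^-1 - e <= pmeas (M n) (small_class r).
Proof.
move=> e0; have [I [F FP]] := finitely_many_subgroups r G_fg.
pose J := [seq i <- enum I | `[< is_subgroup (F i) /\ ~ finite_index (centralizer (F i)) >]].
pose S := [set x : G | index_le [set y | (x * y = y * x)%g] r].
have b0 : 0 < e / 2 / (size J).+1%:R by rewrite divr_gt0 ?ltr0n //; lra.
have [N1 NP] := pmeas_coset_lt M_index b0.
have e2 : 0 < e / 2 by lra.
have [//|n []] := dcM_frequently M_prob M_index (S := S) (r := r) (maxn N N1) alphaM e2.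
rewrite geq_max => /andP[Nn N1n] h; exists n; split=> //.
have sub : S `<=` small_class r `|` [set x | exists2 i, i \in J & centralizer (F i) x].
  move=> x Sx; pose K := [set y | (x * y = y * x)%g].
  have sK : is_subgroup K := centralizer1_subgroup x.
  have cK : centralizer K x by move=> y.
  have [fK|nK] := pselect (finite_index (centralizer K)); first by left; exists K.
  have [i Ki] := FP K sK Sx; right; exists i; last by rewrite -Ki.
  by rewrite mem_filter mem_enum andbT; apply/asboolP; rewrite -Ki.
have := le_trans (pmeasS (M_prob n) sub) (pmeasU_le (M_prob n) _ _).
have : pmeas (M n) [set x | exists2 i, i \in J & centralizer (F i) x] <= e / 2.
  apply: le_trans (pmeas_bigcup_le (M_prob n) (b := e / 2 / (size J).+1%:R) _) _.
    move=> i; rewrite mem_filter => /andP[/asboolP[_ nF] _].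
    have := NP n N1n 1%g _ (centralizer_subgroup (F i)).
    by rewrite left_coset1 inv_index_infinite // add0r => /ltW.
  by rewrite mulrA ler_pdivrMr ?ltr0n // mulrC ler_wpM2l ?ler_nat // ltW.
have c0 : 0 <= r.+1%:R^-1 :> R by rewrite invr_ge0.
have p0 := pmeas_ge0 (M_prob n) S.
move: h; set c := r.+1%:R^-1; set p := pmeas _ S.
have : 0 <= c * p by rewrite mulr_ge0.
rewrite mulrBr mulr1; lra.
Qed.

Lemma small_class_inv_index H : is_subgroup H -> small_class r `<=` H ->
  alpha - r.+1%:R^-1 <= inv_index R H.
Proof.
move=> sH XH; apply/ler_addgt0Pr => e e0; have e2 : 0 < e / 2 by lra.
have [N NP] := pmeas_coset_lt M_index e2.
have [n [Nn]] := small_class_frequently N e2.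
have := NP n Nn 1%g H sH; rewrite left_coset1.
have := pmeasS (M_prob n) XH.
set a := pmeas _ H; set b := pmeas _ _; set c := r.+1%:R^-1; set d := inv_index R H; lra.
Qed.

(** The fibres of [f] are cosets of its kernel, so each has mass about at most [1 / #|f(G)|]; the
    fibres over [X] cover [small_class r]. *)
Lemma small_class_density k (f : G -> {perm 'I_k}) :
  (forall x y, f (x * y) = f x * f y)%g ->
  (alpha - r.+1%:R^-1) * #|perm_image f setT|%:R <= #|perm_image f (small_class r)|%:R.
Proof.
move=> fM; have f1 := perm_rep1 fM; have fV x := perm_repV x fM.
set X := perm_image f (small_class r); pose ker := [set g : G | f g = 1%g].
have sker : is_subgroup ker.
  by split=> [//|x y /= fx fy]; rewrite /ker /= fM fV fx fy mulgV.
have : (0 < #|perm_image f setT|)%N.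
  by apply/card_gt0P; exists 1%g; apply/perm_imageP; exists 1%g.
case Em : #|perm_image f setT| => [//|m] _.
have kerm : inv_index R ker <= m.+1%:R^-1.
  apply: inv_index_le => j /index_eq_le[s [sj scov]].
  apply: leq_trans sj; rewrite -Em -(size_map f); apply: leq_trans (card_size _).
  apply/subset_leq_card/fintype.subsetP => _ /perm_imageP[g _ <-].
  have [x sx] := scov g; rewrite /ker /= fM fV => fxg; apply/mapP; exists x => //.
  by apply: (mulgI (f x)^-1%g); rewrite fxg mulVg.
rewrite -ler_pdivlMr ?ltr0n //; apply/ler_addgt0Pr => e e0.
(* The error is incurred once for each fibre over [X] and once for the mass of [small_class r]. *)
pose e1 := e / (#|X|.+1)%:R.
have e10 : 0 < e1 by rewrite divr_gt0 ?ltr0n.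
have [N NP] := pmeas_coset_lt M_index e10.
have [n [Nn]] := small_class_frequently N e10.
have : pmeas (M n) (small_class r) <= #|X|%:R * (m.+1%:R^-1 + e1).
  apply: le_trans (_ : pmeas (M n) [set x | exists2 p, p \in enum X & f x = p] <= _).
    apply: pmeasS => // x Xx; exists (f x) => //.
    by rewrite mem_enum; apply/perm_imageP; exists x.
  rewrite cardE; apply: (pmeas_bigcup_le (M_prob n) (F := fun p => [set x | f x = p])) => p.
  rewrite mem_enum => /perm_imageP[x _ <-].
  have -> : [set g | f g = f x] = left_coset x ker.
    apply/seteqP; split=> g; rewrite left_cosetE /ker /= fM fV => h; first by rewrite h mulVg.
    by apply: (mulgI (f x)^-1%g); rewrite h mulVg.
  by apply/ltW/(lt_le_trans (NP n Nn x ker sker)); rewrite lerD2r.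
have : e1 + #|X|%:R * e1 = e.
  by rewrite -[X in X + _]mul1r -mulrDl addrC natr1 mulrC divfK ?pnatr_eq0.
rewrite mulrDr; set a := #|X|%:R / _; set b := #|X|%:R * e1; set c := r.+1%:R^-1.
set p := pmeas _ _; lra.
Qed.
End FinitelyGenerated.
End LargeMeasure.

(** * Explicit constants for the third statement *)

Section Numerics.
Local Open Scope ring_scope.
Variable R : realType.
Implicit Types alpha : R.

(** The loss [c] is small enough that [1 / (alpha - c)] stays below [alpha^-1 + 1], and an integer
    below that is at most the ceiling of [alpha^-1]. *)
Lemma le_ceil_of_index alpha (c : R) (k : nat) : 0 < alpha -> alpha <= 1 ->
  c < alpha ^+ 2 / 2 -> k%:R * (alpha - c) <= 1 -> (k%:R : R) <= (Num.ceil alpha^-1)%:~R.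
Proof.
move=> a0 a1 ca kc; have lt : (k%:R : R) < alpha^-1 + 1.
  rewrite ltNge; apply/negP => h.
  have ac : 0 < alpha - alpha ^+ 2 / 2 by nra.
  have : (alpha^-1 + 1) * (alpha - alpha ^+ 2 / 2) < 1.
    apply: le_lt_trans (_ : k%:R * (alpha - alpha ^+ 2 / 2) < _).
      by rewrite ler_wpM2r // ltW.
    apply: lt_le_trans kc; rewrite ltr_pM2l; first by lra.
    by apply: lt_le_trans h; rewrite addr_gt0 ?invr_gt0.
  have -> : (alpha^-1 + 1) * (alpha - alpha ^+ 2 / 2) = 1 + (alpha - alpha ^+ 2) / 2.
    by field; lra.
  nra.
rewrite -[k%:R]/(k%:Z%:~R) ler_int -ltzD1 -(ltr_int R) intrD.
by apply: lt_le_trans lt _; rewrite lerD2r Num.Theory.ceil_ge.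
Qed.

Lemma pow2_le_expR n : ((2 ^ n)%N%:R : R) <= expR n%:R.
Proof.
rewrite natrX -[n%:R]mulr1 expRM_natl lerXn2r ?nnegrE ?expR_ge0 //.
by have := expR_ge1Dx (1 : R); lra.
Qed.

(** [10 * L ^ 9] is at most [10 * 12 ^ 9] times the 18th power of [alpha^-1]; the single constant
    [C] dominates both this coefficient and the exponent 18. *)
Lemma bound_le_expR alpha (L : nat) (C := 18 * 12 ^+ 9 : R) : 0 < alpha -> alpha <= 1 ->
  L%:R <= 12 / alpha ^+ 2 ->
  ((2 ^ (10 * L ^ 9))%N%:R : R) <= expR (C * powR alpha (- C)).
Proof.
move=> a0 a1 La; apply: le_trans (pow2_le_expR _) _; rewrite ler_expR natrM natrX.
have h12 : 1 <= 12 ^+ 9 :> R by apply: exprn_ege1; lra.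
apply: le_trans (_ : 10 * (12 / alpha ^+ 2) ^+ 9 <= _).
  by rewrite ler_wpM2l // lerXn2r ?nnegrE // divr_ge0 // exprn_ge0 // ltW.
have : (alpha ^+ 18)^-1 <= powR alpha (- C).
  rewrite -powR_mulrn ?(ltW a0) // -powRN; apply: ger_powR; first by rewrite a0 a1.
  by rewrite lerN2 /C ler_peMr.
move: h12; rewrite /C; set A := 12 ^+ 9; set P := powR _ _ => h12 aP.
have i0 : 0 <= (alpha ^+ 18)^-1 by rewrite invr_ge0 exprn_ge0 // ltW.
have -> : (12 / alpha ^+ 2) ^+ 9 = A * (alpha ^+ 18)^-1 by rewrite expr_div_n -exprM.
rewrite mulrA; apply: le_trans (_ : 18 * A * (alpha ^+ 18)^-1 <= _).
  by rewrite ler_wpM2r // ler_wpM2r //; lra.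
by rewrite ler_wpM2l //; lra.
Qed.
End Numerics.

Local Open Scope classical_set_scope.
Local Open Scope ring_scope.

(** * Assembling the three statements *)

Section Main.
Variables (R : realType) (G : groupType) (M : nat -> G -> R).
Hypothesis M_prob : forall n, is_prob (M n).
Hypothesis M_index : measures_index_uniformly M.

Lemma abelian_of_dcM : ((5 / 8 : R)%:E < dcM M)%E -> is_abelian G.
Proof.
(* A real [b] is needed below the extended real [dcM M]; if that were infinite, [b = 1] would do.
   Then [b - 1 / 2] exceeds 1/8, which forces index below 4. *)
move=> h; have [b b58 bM] : exists2 b : R, 5 / 8 < b & (b%:E <= dcM M)%E.
  case: (dcM M) h => [b||] //; first by rewrite lte_fin => h; exists b.
  by move=> _; exists 1; rewrite ?leey //; lra.
have [||k Zk k1] := centre_index M_prob M_index (eps := b - 1 / 2); first by lra.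
  by rewrite addrC subrK.
apply: abelian_of_centre_index_le3; apply: index_le_mono (index_eq_le Zk).
rewrite -ltnS -(ltr_nat R); have : 0 <= k%:R :> R by [].
nra.
Qed.

Lemma bounded_by_abelian_by_bounded (alpha : R) (C := 18 * 12 ^+ 9 : R) :
  finitely_generated G -> 0 < alpha -> (alpha%:E <= dcM M)%E ->
  exists (Gamma H : set G) (k : nat),
    is_normal Gamma /\ index_eq Gamma k /\ (k%:R : R) <= (Num.ceil alpha^-1)%:~R /\
    is_normal H /\ card_atmost H (expR (C * powR alpha (- C))) /\
    (H `<=` Gamma) /\
    (forall x y, Gamma x -> Gamma y -> H (x^-1 * y^-1 * x * y)%g).
Proof.
move=> fg a0 aM; have a1 := dcM_le1 M_prob M_index aM.
(* [r] makes [r.+1%:R^-1] less than [alpha ^+ 2 / 2], as the ceiling bound needs; the density is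
   then at least [alpha / 2], hence at least [1 / K]. Both are small enough that [3 * K + r] is at
   most [12 / alpha ^+ 2]. *)
pose r := (Num.truncn (2 / alpha ^+ 2)).+1; pose K := (Num.truncn (2 / alpha)).+1.
have a20 : 0 < alpha ^+ 2 by rewrite exprn_gt0.
have ai1 : 1 <= alpha^-1 by rewrite invf_ge1.
have ai2 : alpha^-1 <= (alpha ^+ 2)^-1.
  by rewrite lef_pV2 ?posrE // expr2 ler_piMr // ltW.
have r1 : 2 / alpha ^+ 2 < r%:R by apply: truncnS_gt.
have r2 : r%:R <= 2 / alpha ^+ 2 + 1.
  by rewrite /r -(natr1 (Num.truncn _)) lerD2r truncn_le // divr_ge0 // ltW.
have K1 : 2 / alpha < K%:R by apply: truncnS_gt.
have K2 : K%:R <= 2 / alpha + 1.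
  by rewrite /K -(natr1 (Num.truncn _)) lerD2r truncn_le // divr_ge0 // ltW.
have c1 : r.+1%:R^-1 < alpha ^+ 2 / 2.
  rewrite -[alpha ^+ 2 / 2]invrK ltf_pV2 ?posrE ?ltr0n ?invr_gt0 ?divr_gt0 //.
  by rewrite invf_div -(natr1 r); apply: lt_trans r1 _; rewrite ltrDl.
have a2a : alpha ^+ 2 <= alpha by rewrite expr2 ler_piMr // ltW.
set c := r.+1%:R^-1 in c1.
pose Gamma := generated (small_class (G := G) r).
have sG : is_subgroup Gamma := generated_subgroup _.
have ac0 : 0 < alpha - c by lra.
have [k Gk k1] := index_of_inv_index ac0
  (small_class_inv_index M_prob M_index fg aM sG (@sub_generated _ _)).
have nG : is_normal Gamma by apply: generated_normal => g h; apply: small_classJ.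
have dens j (f : G -> {perm 'I_j}) : (forall x y, f (x * y) = f x * f y)%g ->
    (#|perm_image f setT| <= K * #|perm_image f (small_class r)|)%N.
  move=> fM; have := small_class_density M_prob M_index r fg aM fM.
  rewrite -/c -(ler_nat R) natrM.
  set a := #|perm_image f setT|%:R; set b := #|_|%:R => ab.
  have a_0 : 0 <= a by rewrite /a.
  have h : alpha / 2 * a <= b by apply: le_trans ab; rewrite ler_wpM2r //; lra.
  have b0 : 0 <= b by rewrite /b.
  apply: le_trans (_ : 2 / alpha * b <= _); last by rewrite ler_wpM2r // ltW.
  by rewrite -invf_div mulrC ler_pdivlMr ?divr_gt0 // mulrC.
(* A witness for any element serves for the identity as well, and an empty [small_class r] would
   contradict its positive mass. *)
have X1 : small_class (G := G) r 1%g.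
  apply: contrapT => X1; have X0 x : ~ small_class (G := G) r x.
    move=> [K' [sK K'r nK cx]]; apply: X1; exists K'; split=> //.
    exact: subgroup1 (centralizer_subgroup _).
  have ac20 : 0 < (alpha - c) / 2 by lra.
  have [n [_]] := small_class_frequently M_prob M_index r fg aM 0 ac20.
  rewrite (_ : small_class r = set0); last by apply/seteqP; split=> // x /X0.
  by rewrite /pmeas esum_set0 /= -/c; lra.
have [s [Hs ss]] := card_derived_small_class fg X1 dens
  (L := (3 * K + r)%N) (leq_addl _ _) (leq_addr _ _).
exists Gamma, (derived Gamma), k; split=> //; split=> //; split.
  exact: (le_ceil_of_index a0 a1 c1 k1).
split; first exact: derived_normal.
split.
  exists s; split=> //; apply: le_trans (bound_le_expR a0 a1 (L := (3 * K + r)%N) _).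
    by rewrite ler_nat.
  rewrite natrD natrM; lra.
split; first exact: derived_sub.
by move=> x y Gx Gy; apply: sub_generated; exists x, y.
Qed.
End Main.

Theorem theorem1p15 (R : realType) :
  (* (1) *)
  (forall (G : groupType) (M : nat -> G -> R),
     countable [set: G] -> (forall n, is_prob (M n)) ->
     measures_index_uniformly M ->
     ((5 / 8 : R)%:E < dcM M)%E -> @is_abelian G)
  /\
  (* (2) *)
  (forall (G : groupType) (M : nat -> G -> R) (eps : R),
     countable [set: G] -> (forall n, is_prob (M n)) ->
     measures_index_uniformly M ->
     0 < eps -> ((1 / 2 + eps)%:E <= dcM M)%E ->
     exists k : nat, index_eq (@centre G) k /\ (k%:R : R) <= eps^-1)
  /\
  (* (3) *)
  (exists C : R, 0 < C /\
     forall (G : groupType) (M : nat -> G -> R) (alpha : R),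
       countable [set: G] -> (forall n, is_prob (M n)) ->
       measures_index_uniformly M ->
       @finitely_generated G ->
       0 < alpha -> (alpha%:E <= dcM M)%E ->
       exists (Gamma H : set G) (k : nat),
         is_normal Gamma /\ index_eq Gamma k /\ (k%:R : R) <= (Num.ceil alpha^-1)%:~R /\
         is_normal H /\ card_atmost H (expR (C * powR alpha (- C))) /\
         (H `<=` Gamma) /\
         (forall x y, Gamma x -> Gamma y -> H (x^-1 * y^-1 * x * y)%g)).
Proof.
split; first by move=> G M _ Mp Mi; apply: abelian_of_dcM.
split.
  move=> G M eps _ Mp Mi eps0 h; have [k Zk k1] := centre_index Mp Mi eps0 h.
  exists k; split=> //; rewrite -[eps^-1]mul1r ler_pdivlMr //.
  have : 0 <= k%:R * eps by rewrite mulr_ge0 // ltW.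
  by move: k1; rewrite mulrCA; lra.
exists (18 * 12 ^+ 9); split; first by rewrite mulr_gt0 ?exprn_gt0.
by move=> G M alpha _ Mp Mi; apply: bounded_by_abelian_by_bounded.
Qed.
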